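(* (i) For each $\varepsilon>0$ there is a constant $K_\varepsilon$ (depending only on $\varepsilon$) such that for all positive integers $m$, $$\lambda(m)\le K_\varepsilon m^{\varepsilon}.$$ (ii) For each $\varepsilon>0$ there is a constant $K_\varepsilon$ (depending only on $\varepsilon$) such that for all positive integers $m$ and every $m\times m$ complex matrix $A$ with zero trace there are an $m\times m$ normal matrix $B$ with spectrum in the square $[-1,1]\times[-\imath,\imath]$ and an $m\times m$ complex matrix $C$ with $\|C\|\le K_\varepsilon m^{\varepsilon}\|A\|$ such that $A=[B,C]$.
   Context: All matrices are complex. $\|D\|$ denotes the norm of an $m\times m$ matrix $D$ as an operator from $\ell_2^m$ to itself. $[B,C]=BC-CB$. The set $[-1,1]\times[-\imath,\imath]$ is the closed square $\{x+\imath y: x,y\in[-1,1]\}\subset\mathbb{C}$, where $\imath=\sqrt{-1}$. For an $m\times m$ matrix $A$ with zero diagonal (all diagonal entries equal to $0$), $\lambda(A)$ denotes the smallest number $\lambda$ such that there are an $m\times m$ diagonal matrix $B$ with diagonal elements in $[-1,1]\times[-\imath,\imath]$ and an $m\times m$ matrix $C$ such that $A=[B,C]$ and $\|C\|\le\lambda$. $\lambda(m)$ denotes the maximum (understood as a supremum) of $\lambda(A)$ over all $m\times m$ matrices $A$ of zero diagonal and norm one, with the convention $\lambda(1)=0$. *)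

(* Defs.v *)
From mathcomp Require Export all_boot all_order all_algebra.
From mathcomp Require Export all_classical all_reals all_analysis.
From mathcomp Require Export complex.

Set Implicit Arguments.
Unset Strict Implicit.
Unset Printing Implicit Defensive.

Import Order.TTheory GRing.Theory Num.Theory.

Local Open Scope classical_set_scope.
Local Open Scope ring_scope.

Definition l2norm (R : realType) (m : nat) (x : 'cV[R[i]]_m) : R :=
  Num.sqrt (\sum_(j < m) Normc.normc (x j 0) ^+ 2).

(* The supremum is over a nonempty bounded set, so the default value of [sup]
   never intervenes.  This is not the entrywise norm that the library puts on
   matrices. *)
Definition opnorm (R : realType) (m : nat) (D : 'M[R[i]]_m) : R :=
  sup [set l2norm (D *m x) | x in [set x : 'cV[R[i]]_m | l2norm x <= 1]].

Definition commutator (R : realType) (m : nat) (B C : 'M[R[i]]_m) : 'M[R[i]]_m :=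
  B *m C - C *m B.

Definition centered_square (R : realType) : set R[i] :=
  [set z : R[i] | -1 <= complex.Re z <= 1 /\ -1 <= complex.Im z <= 1].

Definition zero_diagonal (R : realType) (m : nat) (A : 'M[R[i]]_m) : Prop :=
  forall j, A j j = 0.

(* Both extremal quantities are taken in the extended reals: a matrix admitting
   no representation A = [B, C] would get the value +oo, and an unbounded family
   of values of [lambda_mx] would make [lambda] equal to +oo, instead of the
   default value 0 of [inf] and [sup] on real sets. *)
Definition lambda_mx (R : realType) (m : nat) (A : 'M[R[i]]_m) : \bar R :=
  ereal_inf [set l%:E | l in [set l : R |
    exists B C : 'M[R[i]]_m,
      [/\ is_diag_mx B, (forall j, centered_square (B j j)),
          A = commutator B C & opnorm C <= l]]].

(* No 1 x 1 matrix with zero diagonal has norm one, hence the separate case. *)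
Definition lambda (R : realType) (m : nat) : \bar R :=
  if m == 1%N then 0%E else
  ereal_sup [set lambda_mx A | A in
    [set A : 'M[R[i]]_m | zero_diagonal A /\ opnorm A = 1]].

(* Main.v *)
Require Import Defs.
From mathcomp Require Import spectral sesquilinear ring lra zify.
Import Order.TTheory GRing.Theory Num.Theory.
Local Open Scope ring_scope.
Local Open Scope sesquilinear_scope.
Local Open Scope complex_scope.
Set Implicit Arguments.
Unset Strict Implicit.
Unset Printing Implicit Defensive.

(** The two parts follow from one estimate on zero-diagonal matrices
    ([solvable_powR]): if [A] has zero diagonal and [S] is a set of indices,
    the compression of [A] to [S] is a commutator [[B, X]] with [B] diagonal,
    entries in the square, and the norm of [X] at most
    [K_eps * |S| ^ eps * |A|].  Part (i) is the case where [S] is everything;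
    for part (ii) a matrix of zero trace is unitarily equivalent to one of zero
    diagonal ([zero_diagonal_unitary]), and conjugating by a unitary turns the
    diagonal [B] into a normal one without changing norms or spectrum.

    The estimate is proved by strong induction on [|S|].  Cut the square
    into an n x n grid of cells and the indices into at most [n ^ 2] classes,
    and let the part of [B] on a class be a copy, shrunk by [2 n] and moved
    into the cell of the class, of a solution for that class.  The diagonal
    blocks then cost [2 n] times the worst class; the off-diagonal blocks are
    Sylvester equations between separated spectra and cost a constant that
    depends on [n] only ([solvable_grid]).

    For this to be affordable the blocks must be small.  A theorem of Bourgain
    and Tzafriri says that a zero-diagonal contraction has, for each [delta], a
    principal submatrix of norm at most [delta] on a fraction
    [c delta ^ 2] of the indices ([small_compression]).  Extracting such
    submatrices repeatedly, [4 ^ L * L] classes of norm [O(2 ^ - L)] exhaust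
    all but a fraction [2 ^ - L] of [S]
    ([partition_small_compressions]).  The grid has [n = 2 ^ L * L], so the
    factor [2 n] and the gain [O(2 ^ - L)] leave only [O(L)]; the rest of [S]
    is placed, without any gain, in one cell of a 2 x 2 grid, the other
    classes in another.  Altogether a factor [O(L)] is paid for a reduction of
    the size by [2 ^ (L - 1)] ([solvable_step]).  As [L] is eventually smaller
    than [(2 ^ (L - 1)) ^ eps], a large fixed [L] gives the bound
    [|S| ^ eps].

    The submatrix is found by a greedy barrier argument.  For Hermitian [H] and
    a level [t] above the spectrum of the principal submatrix [H_sigma], the
    trace of the resolvent [(t - H_sigma)^-1] measures how close the spectrum
    is to [t].  Adding an index changes the resolvent by a rank-one matrix
    ([resolvent_extend]), raising [t] decreases the trace
    ([resolvent_shift]), and on average over the free indices the increase is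
    compensated by the decrease.  The four matrices [+- Re A], [+- Im A] are
    handled simultaneously, because an average controls the sum of the four
    increases ([greedy_step]). *)

(** * The real inner product and bounds on operators *)

Section RealInner.
Variable R : realType.
Local Notation C := R[i].

Lemma conjC_conjc (z : C) : Num.conj z = conjc z. Proof. by []. Qed.

Lemma ReD (z w : C) : complex.Re (z + w) = complex.Re z + complex.Re w.
Proof. by case: z; case: w. Qed.

Lemma ReN (z : C) : complex.Re (- z) = - complex.Re z.
Proof. by case: z. Qed.

Lemma ReZ (a : R) (z : C) : complex.Re (a%:C * z) = a * complex.Re z.
Proof. by case: z => x y /=; rewrite mul0r subr0. Qed.

Lemma Re_conj (z : C) : complex.Re (Num.conj z) = complex.Re z.
Proof. by case: z. Qed.

Lemma Re_sum (I : Type) (r : seq I) (P : pred I) (F : I -> C) :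
  complex.Re (\sum_(i <- r | P i) F i) = \sum_(i <- r | P i) complex.Re (F i).
Proof. by apply: (big_morph _ ReD). Qed.

Lemma conjC_real (a : R) : Num.conj (a%:C) = a%:C :> C.
Proof. by rewrite conjC_conjc /= oppr0. Qed.

Lemma normcZ (a : R) : Normc.normc (a%:C : C) = `|a|.
Proof. by rewrite /= expr0n /= addr0 sqrtr_sqr. Qed.

Lemma normc_nonneg (z : C) : 0 <= Normc.normc z.
Proof. by case: z => a b; rewrite /= sqrtr_ge0. Qed.

Lemma sqr_normcE (z : C) :
  Normc.normc z ^+ 2 = complex.Re z ^+ 2 + complex.Im z ^+ 2.
Proof. by case: z => a b /=; rewrite sqr_sqrtr // addr_ge0 ?sqr_ge0. Qed.

Lemma adjmxK m n (M : 'M[C]_(m, n)) : M^t*^t* = M.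
Proof. exact: trmxCK. Qed.

Lemma adjmxM m n p (A : 'M[C]_(m, n)) (B : 'M[C]_(n, p)) :
  (A *m B)^t* = B^t* *m A^t*.
Proof. by rewrite trmx_mul map_mxM. Qed.

Lemma adjmxD m n (A B : 'M[C]_(m, n)) : (A + B)^t* = A^t* + B^t*.
Proof. by rewrite linearD map_mxD. Qed.

Lemma adjmxB m n (A B : 'M[C]_(m, n)) : (A - B)^t* = A^t* - B^t*.
Proof. by rewrite linearB map_mxB. Qed.

Lemma adjmxZ m n (c : C) (A : 'M[C]_(m, n)) : (c *: A)^t* = Num.conj c *: A^t*.
Proof. by rewrite linearZ map_mxZ. Qed.

Lemma adjmx1 m : (1%:M : 'M[C]_m)^t* = 1%:M.
Proof. by rewrite trmx1 map_mx1. Qed.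

Lemma adjmx_real m (a : R) : ((a%:C)%:M : 'M[C]_m)^t* = (a%:C)%:M.
Proof. by rewrite tr_scalar_mx map_scalar_mx; congr (_%:M); apply: conjC_real. Qed.

(** The real part of the Hermitian inner product: it determines the same norm,
    and takes values in an ordered field. *)
Definition rdot m (x y : 'cV[C]_m) : R := complex.Re ((x^t* *m y) 0 0).

Lemma rdotC m (x y : 'cV[C]_m) : rdot x y = rdot y x.
Proof.
rewrite /rdot -[LHS]Re_conj; congr complex.Re.
by rewrite -[y^t* *m x](adjmxK) adjmxM adjmxK !mxE.
Qed.

Lemma rdotDl m (x y z : 'cV[C]_m) : rdot (x + y) z = rdot x z + rdot y z.
Proof. by rewrite /rdot adjmxD mulmxDl mxE ReD. Qed.

Lemma rdotDr m (x y z : 'cV[C]_m) : rdot z (x + y) = rdot z x + rdot z y.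
Proof. by rewrite rdotC rdotDl !(rdotC z). Qed.

Lemma rdotZr m (a : R) (x y : 'cV[C]_m) : rdot x (a%:C *: y) = a * rdot x y.
Proof. by rewrite /rdot -scalemxAr mxE ReZ. Qed.

Lemma rdotZl m (a : R) (x y : 'cV[C]_m) : rdot (a%:C *: x) y = a * rdot x y.
Proof. by rewrite rdotC rdotZr rdotC. Qed.

Lemma rdotNr m (x y : 'cV[C]_m) : rdot x (- y) = - rdot x y.
Proof. by rewrite /rdot mulmxN mxE ReN. Qed.

Lemma rdotNl m (x y : 'cV[C]_m) : rdot (- x) y = - rdot x y.
Proof. by rewrite rdotC rdotNr rdotC. Qed.

Lemma rdotMl m n (M : 'M[C]_(m, n)) x y : rdot (M *m x) y = rdot x (M^t* *m y).
Proof. by rewrite /rdot adjmxM mulmxA. Qed.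

Lemma rdot0r m (x : 'cV[C]_m) : rdot x 0 = 0.
Proof. by rewrite /rdot mulmx0 mxE. Qed.

Lemma rdotxx m (x : 'cV[C]_m) : rdot x x = \sum_j Normc.normc (x j 0) ^+ 2.
Proof.
rewrite /rdot mxE Re_sum; apply: eq_bigr => j _; rewrite !mxE sqr_normcE.
by case: (x j 0) => a b /=; ring.
Qed.

Lemma rdotxx_ge0 m (x : 'cV[C]_m) : 0 <= rdot x x.
Proof. by rewrite rdotxx sumr_ge0 // => j _; rewrite sqr_ge0. Qed.

Lemma rdotxx_eq0 m (x : 'cV[C]_m) : rdot x x = 0 -> x = 0.
Proof.
rewrite rdotxx => /eqP; rewrite psumr_eq0; last by move=> *; rewrite sqr_ge0.
move=> /allP x0; apply/matrixP => j k; rewrite (ord1 k) mxE.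
have /implyP/(_ isT) := x0 j (mem_index_enum _).
by rewrite sqrf_eq0 => /eqP/Normc.eq0_normc.
Qed.

Lemma rdotxx_Z m (c : C) (x : 'cV[C]_m) :
  rdot (c *: x) (c *: x) = Normc.normc c ^+ 2 * rdot x x.
Proof.
rewrite !rdotxx mulr_sumr; apply: eq_bigr => j _.
by rewrite mxE Normc.normcM exprMn.
Qed.

Lemma l2normE m (x : 'cV[C]_m) : l2norm x = Num.sqrt (rdot x x).
Proof. by rewrite rdotxx. Qed.

Lemma l2norm_ge0 m (x : 'cV[C]_m) : 0 <= l2norm x.
Proof. exact: sqrtr_ge0. Qed.

Lemma sqr_l2norm m (x : 'cV[C]_m) : l2norm x ^+ 2 = rdot x x.
Proof. by rewrite l2normE sqr_sqrtr ?rdotxx_ge0. Qed.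

Lemma l2normZ m (c : C) (x : 'cV[C]_m) :
  l2norm (c *: x) = Normc.normc c * l2norm x.
Proof.
by rewrite !l2normE rdotxx_Z sqrtrM ?sqr_ge0 // sqrtr_sqr ger0_norm ?normc_nonneg.
Qed.

Lemma l2norm0 m : l2norm (0 : 'cV[C]_m) = 0.
Proof. by rewrite l2normE rdot0r sqrtr0. Qed.

Lemma l2norm_eq0 m (x : 'cV[C]_m) : l2norm x = 0 -> x = 0.
Proof.
by move=> x0; apply: rdotxx_eq0; rewrite -sqr_l2norm x0 expr0n.
Qed.

Lemma rdot_le m (x y : 'cV[C]_m) : rdot x y <= l2norm x * l2norm y.
Proof.
have [x0|x0] := eqVneq (l2norm x) 0.
  by rewrite (l2norm_eq0 x0) rdotC rdot0r l2norm0 mul0r.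
have [y0|y0] := eqVneq (l2norm y) 0.
  by rewrite (l2norm_eq0 y0) rdot0r l2norm0 mulr0.
have px : 0 < l2norm x by rewrite lt_def x0 l2norm_ge0.
have py : 0 < l2norm y by rewrite lt_def y0 l2norm_ge0.
have := rdotxx_ge0 ((l2norm y)%:C *: x - (l2norm x)%:C *: y).
rewrite rdotDl !rdotDr !rdotNl !rdotNr !rdotZl !rdotZr (rdotC y x) -!sqr_l2norm.
move=> H; have {}H : 0 <= (l2norm x * l2norm y) * (l2norm x * l2norm y - rdot x y) by nra.
by move: H; rewrite pmulr_rge0 ?mulr_gt0 // subr_ge0.
Qed.

Lemma l2normD m (x y : 'cV[C]_m) : l2norm (x + y) <= l2norm x + l2norm y.
Proof.
rewrite -(ler_pXn2r (n := 2)) ?nnegrE ?addr_ge0 ?l2norm_ge0 //.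
rewrite sqr_l2norm rdotDl !rdotDr (rdotC y x) -!sqr_l2norm.
have := rdot_le x y; nra.
Qed.

Lemma l2normN m (x : 'cV[C]_m) : l2norm (- x) = l2norm x.
Proof. by rewrite !l2normE rdotNl rdotNr opprK. Qed.

End RealInner.

Section OperatorBound.
Variables (R : realType) (m : nat).
Local Notation C := R[i].
Implicit Types (D E : 'M[C]_m) (a b : R) (x y : 'cV[C]_m).

Definition opbound a D := 0 <= a /\ forall x, l2norm (D *m x) <= a * l2norm x.

Lemma opbound_sqr a D : 0 <= a ->
  (forall x, rdot (D *m x) (D *m x) <= a ^+ 2 * rdot x x) -> opbound a D.
Proof.
move=> a0 H; split=> // x.
rewrite -(ler_pXn2r (n := 2)) ?nnegrE ?mulr_ge0 ?l2norm_ge0 //.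
by rewrite exprMn !sqr_l2norm.
Qed.

Lemma opbound_rdot a D x : opbound a D ->
  rdot (D *m x) (D *m x) <= a ^+ 2 * rdot x x.
Proof.
case=> a0 /(_ x); rewrite -!sqr_l2norm -exprMn => H.
by rewrite ler_pXn2r ?nnegrE ?mulr_ge0 ?l2norm_ge0.
Qed.

Lemma opbound_le a b D : a <= b -> opbound a D -> opbound b D.
Proof.
move=> ab [a0 H]; split=> [|x]; first exact: le_trans ab.
by apply: le_trans (H x) _; rewrite ler_wpM2r ?l2norm_ge0.
Qed.

Lemma opbound0 : opbound 0 0.
Proof. by split=> // x; rewrite mul0mx l2norm0 mul0r. Qed.

Lemma opboundD a b D E : opbound a D -> opbound b E -> opbound (a + b) (D + E).
Proof.
move=> [a0 HD] [b0 HE]; split=> [|x]; first exact: addr_ge0.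
by rewrite mulmxDl mulrDl; apply: le_trans (l2normD _ _) _; rewrite lerD.
Qed.

Lemma opboundM a b D E : opbound a D -> opbound b E -> opbound (a * b) (D *m E).
Proof.
move=> [a0 HD] [b0 HE]; split=> [|x]; first exact: mulr_ge0.
by rewrite -mulmxA -mulrA; apply: le_trans (HD _) _; rewrite ler_wpM2l.
Qed.

Lemma opboundZ a c D : opbound a D -> opbound (Normc.normc c * a) (c *: D).
Proof.
move=> [a0 HD]; split=> [|x]; first by rewrite mulr_ge0 ?normc_nonneg.
by rewrite -scalemxAl l2normZ -mulrA ler_wpM2l ?normc_nonneg.
Qed.

Lemma opboundN a D : opbound a D -> opbound a (- D).
Proof. by case=> a0 HD; split=> // x; rewrite mulNmx l2normN. Qed.

Lemma opboundB a b D E : opbound a D -> opbound b E -> opbound (a + b) (D - E).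
Proof. by move=> HD /opboundN; apply: opboundD. Qed.

Lemma opbound_sum (I : finType) (P : pred I) (F : I -> 'M[C]_m) a :
  0 <= a -> (forall i, P i -> opbound a (F i)) ->
  opbound (#|I|%:R * a) (\sum_(i | P i) F i).
Proof.
move=> a0 H; apply: (@opbound_le (\sum_(i | P i) a)).
  rewrite sumr_const -[_ *+ _]mulr_natl ler_wpM2r // ler_nat; exact: max_card.
apply: (big_rec2 (fun (s : R) (M : 'M[C]_m) => opbound s M)); first exact: opbound0.
by move=> i s M Pi; apply: opboundD; apply: H.
Qed.

(** [|D^* x|^2 = Re <D D^* x, x> <= a |D^* x| |x|]. *)
Lemma opbound_adj a D : opbound a D -> opbound a (D^t*).
Proof.
case=> a0 HD; split=> // x.
have [->|x0] := eqVneq (l2norm (D^t* *m x)) 0.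
  by rewrite mulr_ge0 ?l2norm_ge0.
have px : 0 < l2norm (D^t* *m x) by rewrite lt_def x0 l2norm_ge0.
rewrite -(ler_pM2l px) -expr2 sqr_l2norm rdotMl adjmxK.
apply: le_trans (rdot_le _ _) _; rewrite mulrC mulrCA mulrA.
by rewrite ler_wpM2r ?l2norm_ge0 // mulrC.
Qed.

Lemma opbound_unitary U : U \is unitarymx -> opbound 1 U.
Proof.
move=> /unitarymxP UU; apply: opbound_sqr => // x.
by rewrite rdotMl mulmxA (mulmx1C UU) mul1mx expr1n mul1r.
Qed.

(** In finite dimension every matrix is bounded: it is a finite sum of its
    entries times matrix units. Without this the supremum that defines
    [opnorm] could be a default value. *)
Lemma opbound_exists D : exists a, opbound a D.
Proof.
pose s i : 'M[C]_m := delta_mx i i.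
have sb i : opbound 1 (s i).
  apply: opbound_sqr => // x; rewrite expr1n mul1r !rdotxx.
  apply: ler_sum => j _; rewrite mxE (bigD1 i) //= big1 ?addr0; last first.
    by move=> k ki; rewrite mxE (negPf ki) andbF mul0r.
  rewrite mxE eqxx andbT; have [->|_] := eqVneq j i; first by rewrite mul1r.
  by rewrite mul0r Normc.normc0 expr0n sqr_ge0.
have eb i j : exists a, opbound a (s i *m D *m s j).
  exists (Normc.normc (D i j)); apply: opbound_sqr; first exact: normc_nonneg.
  move=> x; rewrite !rdotxx mulr_sumr.
  have E k : (s i *m D *m s j *m x) k 0 = (k == i)%:R * (D i j * x j 0).
    rewrite -!mulmxA.
    have -> : s j *m x = x j 0 *: (delta_mx j 0 : 'cV_m).
      apply/colP => l; rewrite !mxE (bigD1 j) //= big1 ?addr0.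
        by rewrite !mxE !eqxx andbT mulrC.
      by move=> t tj; rewrite mxE (negPf tj) andbF mul0r.
    rewrite -scalemxAr -scalemxAr mxE -colE mxE (bigD1 i) //= big1 ?addr0.
      by rewrite !mxE !eqxx andbT; ring.
    by move=> t ti; rewrite !mxE (negPf ti) andbF mul0r.
  rewrite (bigD1 i) //= [X in _ + X]big1 ?addr0; last first.
    move=> k ki; rewrite E (negPf ki) mul0r Normc.normc0.
    by rewrite expr0n.
  rewrite E eqxx mul1r Normc.normcM exprMn (bigD1 j) //=.
  rewrite lerDl sumr_ge0 // => k _; by rewrite mulr_ge0 ?sqr_ge0.
have s1 : \sum_i s i = 1%:M.
  apply/matrixP => i j; rewrite summxE mxE (bigD1 i) //= big1 ?addr0.
    by rewrite mxE eqxx eq_sym.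
  by move=> k ki; rewrite mxE eq_sym (negPf ki).
have -> : D = \sum_i \sum_j s i *m D *m s j.
  transitivity (\sum_i s i *m D); first by rewrite -mulmx_suml s1 mul1mx.
  by apply: eq_bigr => i _; rewrite -mulmx_sumr s1 mulmx1.
pose good (M : 'M[C]_m) := exists a, opbound a M.
have good0 : good 0 by exists 0; exact: opbound0.
have goodD M N : good M -> good N -> good (M + N).
  by case=> a Ha [b Hb]; exists (a + b); apply: opboundD.
apply: (big_ind good good0 goodD) => i _.
by apply: (big_ind good good0 goodD) => j _; apply: eb.
Qed.

Lemma opnorm_le a D : opbound a D -> opnorm D <= a.
Proof.
case=> a0 HD; apply: ge_sup.
  by exists (l2norm (D *m 0)); exists 0 => //=; rewrite l2norm0.
move=> _ [x /= x1 <-]; apply: le_trans (HD x) _.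
by rewrite ler_piMr.
Qed.

(** The bound holds on the unit ball by definition of the supremum, and
    everywhere by homogeneity. *)
Lemma opbound_opnorm D : opbound (opnorm D) D.
Proof.
have [a [a0 Ha]] := opbound_exists D.
have ub : has_ubound [set l2norm (D *m x) | x in [set x : 'cV[C]_m | l2norm x <= 1]]%classic.
  exists a => _ [x /= x1 <-]; apply: le_trans (Ha x) _.
  by rewrite ler_piMr.
have le1 x : l2norm x <= 1 -> l2norm (D *m x) <= opnorm D.
  by move=> x1; apply: ub_le_sup => //; exists x.
have N0 : 0 <= opnorm D.
  by have := le1 0; rewrite mulmx0 !l2norm0 => -> //; exact: ler01.
split=> // x; have [x0|x0] := eqVneq (l2norm x) 0.
  by rewrite (l2norm_eq0 x0) mulmx0 l2norm0 mulr0.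
have px : 0 < l2norm x by rewrite lt_def x0 l2norm_ge0.
have := le1 ((l2norm x)^-1%:C *: x).
rewrite -scalemxAr !l2normZ normcZ ger0_norm ?invr_ge0 ?l2norm_ge0 //.
by rewrite mulVf // lexx => /(_ isT); rewrite mulrC ler_pdivrMr.
Qed.

End OperatorBound.

(** * Positive semidefinite matrices and coordinate projections *)

Section Positive.
Variables (R : realType) (m : nat).
Local Notation C := R[i].
Implicit Types (W K M : 'M[C]_m) (x y : 'cV[C]_m) (S : {set 'I_m}).

Definition retr W : R := complex.Re (\tr W).
Definition basis (i : 'I_m) : 'cV[C]_m := delta_mx i 0.

Lemma retrD W K : retr (W + K) = retr W + retr K.
Proof. by rewrite /retr mxtraceD ReD. Qed.

Lemma retrN W : retr (- W) = - retr W.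
Proof. by rewrite /retr linearN ReN. Qed.

Lemma retrZ (a : R) W : retr (a%:C *: W) = a * retr W.
Proof. by rewrite /retr mxtraceZ ReZ. Qed.

Lemma retrC W K : retr (W *m K) = retr (K *m W).
Proof. by rewrite /retr mxtrace_mulC. Qed.

Lemma basis_entry M i j : (basis i)^t* *m M *m basis j = (M i j)%:M.
Proof.
rewrite [LHS]mx11_scalar -mulmxA -colE mxE (bigD1 i) //= big1 ?addr0.
  by rewrite !mxE !eqxx conjC1 mul1r.
by move=> k ki; rewrite !mxE (negPf ki) conjC0 mul0r.
Qed.

Lemma rdot_basis M i j : rdot (basis i) (M *m basis j) = complex.Re (M i j).
Proof. by rewrite /rdot mulmxA basis_entry mxE eqxx. Qed.

Lemma retrE W : retr W = \sum_i rdot (basis i) (W *m basis i).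
Proof. by rewrite /retr Re_sum; apply: eq_bigr => i _; rewrite rdot_basis. Qed.

Definition psd W := W^t* = W /\ forall x, 0 <= rdot x (W *m x).

Lemma psd0 : psd 0.
Proof. by split=> [|x]; rewrite ?mul0mx ?rdot0r // trmx0 map_mx0. Qed.

Lemma psdD W K : psd W -> psd K -> psd (W + K).
Proof.
move=> [hW pW] [hK pK]; split=> [|x]; first by rewrite adjmxD hW hK.
by rewrite mulmxDl rdotDr addr_ge0.
Qed.

Lemma psdZ (a : R) W : 0 <= a -> psd W -> psd (a%:C *: W).
Proof.
move=> a0 [hW pW]; split=> [|x]; first by rewrite adjmxZ conjC_real hW.
by rewrite -scalemxAl rdotZr mulr_ge0.
Qed.

Lemma psd_conj W M : psd W -> psd (M^t* *m W *m M).
Proof.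
move=> [hW pW]; split=> [|x]; first by rewrite !adjmxM adjmxK hW mulmxA.
by rewrite -!mulmxA -rdotMl.
Qed.

Lemma psd_gram n (v : 'M[C]_(m, n)) : psd (v *m v^t*).
Proof.
split=> [|x]; first by rewrite adjmxM adjmxK.
by rewrite -mulmxA rdotC rdotMl rdotxx_ge0.
Qed.

Lemma psd_sqr W : W^t* = W -> psd (W *m W).
Proof. by move=> hW; rewrite -[X in W *m X]hW; apply: psd_gram. Qed.

Lemma retr_psd_ge0 W : psd W -> 0 <= retr W.
Proof. by case=> _ pW; rewrite retrE sumr_ge0. Qed.

Lemma herm_diag_real W i : W^t* = W -> W i i = (complex.Re (W i i))%:C.
Proof.
move=> /matrixP/(_ i i); rewrite !mxE; case: (W i i) => a b [] E.
by congr (_ +i* _); lra.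
Qed.

Lemma psd_diag_ge0 W i : psd W -> 0 <= complex.Re (W i i).
Proof. by case=> _ pW; rewrite -rdot_basis. Qed.

(** In an eigenbasis of [W] the trace is the sum of the products of the
    eigenvalues of [W] with the diagonal entries of [K], all nonnegative. *)
Lemma retr_psdM_ge0 W K : psd W -> psd K -> 0 <= retr (W *m K).
Proof.
move=> pW pK; have hW : W \is normalmx by apply/normalmxP; rewrite pW.1.
have uP := spectral_unitarymx W; have /unitarymxP UU := uP.
have WE := orthomx_spectralP hW; rewrite (invmx_unitary uP) in WE.
move: (spectralmx W) (spectral_diag W) uP UU WE => P d _ UU WE.
have pW' : psd (diag_mx d).
  have -> : diag_mx d = P^t*^t* *m W *m P^t*.
    by rewrite WE adjmxK !mulmxA UU mul1mx -mulmxA UU mulmx1.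
  exact: psd_conj.
have pK' : psd (P *m K *m P^t*) by have := psd_conj (P^t*) pK; rewrite adjmxK.
have cyc (X Y Z : 'M[C]_m) : retr (X *m Y *m Z *m K) = retr (Y *m (Z *m K *m X)).
  by rewrite -!mulmxA retrC !mulmxA.
rewrite {1}WE cyc; clear cyc WE.
rewrite /retr Re_sum; apply: sumr_ge0 => i _; rewrite mul_diag_mx mxE.
rewrite (herm_diag_real i pK'.1).
have dE := herm_diag_real i pW'.1.
have := psd_diag_ge0 i pW'; have := psd_diag_ge0 i pK'.
by move: dE; rewrite [diag_mx d i i]mxE eqxx mulr1n => -> k0 d0; rewrite ReZ mulr_ge0.
Qed.

Definition proj S : 'M[C]_m := diag_mx (\row_j (j \in S)%:R).

Lemma proj_mulE S n (M : 'M[C]_(m, n)) i j : (proj S *m M) i j = (i \in S)%:R * M i j.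
Proof. by rewrite mul_diag_mx !mxE. Qed.

Lemma mul_projE S n (M : 'M[C]_(n, m)) i j : (M *m proj S) i j = M i j * (j \in S)%:R.
Proof. by rewrite mul_mx_diag !mxE. Qed.

Lemma projM S T : proj S *m proj T = proj (S :&: T).
Proof.
apply/matrixP => i j; rewrite proj_mulE !mxE finset.in_setI.
by case: eqP => _; rewrite ?mulr1n ?mulr0n ?mulr0 // -natrM mulnb.
Qed.

Lemma proj_id S : proj S *m proj S = proj S.
Proof. by rewrite projM finset.setIid. Qed.

Lemma adj_proj S : (proj S)^t* = proj S.
Proof.
apply/matrixP => i j; rewrite !mxE eq_sym.
by case: eqP => [->|_]; rewrite ?mulr1n ?mulr0n ?conjC0 ?conjC_nat.
Qed.

Lemma proj_basis S i : proj S *m basis i = (i \in S)%:R *: basis i.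
Proof.
apply/colP => j; rewrite proj_mulE !mxE.
by have [->|_] := eqVneq j i; rewrite ?mulr0.
Qed.

Lemma projU1 S i : i \notin S -> proj (i |: S) = proj S + basis i *m (basis i)^t*.
Proof.
move=> iS; apply/matrixP => j k; rewrite !mxE big_ord1 !mxE !eqxx !andbT finset.in_setU1.
rewrite conjC_nat; have [->|ji] := eqVneq j i.
  rewrite orTb (negPf iS) mul0rn add0r mul1r [k == i]eq_sym.
  by case: (i == k).
by rewrite mul0r addr0.
Qed.

Lemma opbound_proj S : opbound 1 (proj S).
Proof.
apply: opbound_sqr => // x; rewrite expr1n mul1r !rdotxx.
apply: ler_sum => j _; rewrite proj_mulE; case: (j \in S); rewrite ?mul1r //.
by rewrite mul0r Normc.normc0 expr0n sqr_ge0.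
Qed.

End Positive.

(** * Resolvents of principal submatrices *)

Section Resolvent.
Variables (R : realType) (m : nat).
Local Notation C := R[i].
Implicit Types (H W M : 'M[C]_m) (S : {set 'I_m}).

(** The inverse of the block of [t - H] on [S], extended by zero. Keeping the
    full size avoids changing the index type when [S] grows, and positivity of
    the inverse replaces the statement that [t] lies above the spectrum of the
    block. *)
Definition resolvent H S (t : R) W :=
  [/\ psd W, proj R S *m W = W & W *m ((t%:C)%:M - H) *m proj R S = proj R S].

Lemma resolvent_projr H S t W : resolvent H S t W -> W *m proj R S = W.
Proof. by case=> [[hW _] PW _]; rewrite -hW -[in RHS]PW adjmxM adj_proj. Qed.

Lemma resolvent0 H t : resolvent H finset.set0 t 0.
Proof.
have p0 : proj R finset.set0 = (0 : 'M[C]_m).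
  by apply/matrixP => i j; rewrite !mxE finset.in_set0 mul0rn.
by split; rewrite ?p0 ?mulmx0 //; apply: psd0.
Qed.

(** A matrix with a positive semidefinite inverse is itself positive
    semidefinite: with [M = t - H], on the block [M = M W M]. *)
Lemma resolvent_psd H S t W : H^t* = H -> resolvent H S t W ->
  psd (proj R S *m ((t%:C)%:M - H) *m proj R S).
Proof.
move=> hH [pW PW WP]; set M := (t%:C)%:M - H in WP *.
have hM : M^t* = M by rewrite adjmxB hH adjmx_real.
suff -> : proj R S *m M *m proj R S = (M *m proj R S)^t* *m W *m (M *m proj R S).
  exact: psd_conj.
by rewrite adjmxM hM adj_proj -!mulmxA [W *m _]mulmxA WP.
Qed.

(** The inverse of a bordered matrix, by the Schur complement [s]. Since the
    inverse changes by the rank-one matrix [u u^* / s] with [u = e_i + W a],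
    [a] being the column of [H] at [i] restricted to [S], positivity persists
    exactly when [s] is positive, and the trace grows by [|u|^2 / s = (1 + |W
    a|^2) / s]. *)
Lemma resolvent_extend H S t W i :
  let v := W *m (proj R S *m H *m basis R i) in
  let s := t - rdot (proj R S *m H *m basis R i) v in
  H^t* = H -> H i i = 0 -> i \notin S -> resolvent H S t W -> 0 < s ->
  exists W', resolvent H (i |: S) t W' /\
    retr W' = retr W + (1 + rdot v v) / s.
Proof.
set e := basis R i; set P := proj R S; set a := P *m H *m e.
move=> v s hH Hii iS cert s0; have WP := resolvent_projr cert.
case: cert => pW PW WR; rewrite -/P in WP PW WR.
have Pe : P *m e = 0 by rewrite proj_basis (negPf iS) scale0r.
have We : W *m e = 0 by rewrite -WP -mulmxA Pe mulmx0.
have ee : e^t* *m e = 1%:M.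
  by have := basis_entry (1%:M : 'M[C]_m) i i; rewrite mulmx1 mxE eqxx.
have eP : e^t* *m P = 0 by rewrite -[P]adj_proj -adjmxM Pe trmx0 map_mx0.
have aE : a^t* = e^t* *m H *m P by rewrite !adjmxM hH adj_proj mulmxA.
have vE : v^t* = a^t* *m W by rewrite /v -/a adjmxM pW.1.
have [u uD] : exists u, u = e + v by exists (e + v).
have uE : u^t* = e^t* + a^t* *m W by rewrite uD adjmxD vE.
have eHe : e^t* *m H *m e = 0 by rewrite basis_entry Hii raddf0.
have WMe : W *m ((t%:C)%:M - H) *m e = - v.
  rewrite mulmxBr mulmxBl mul_mx_scalar -scalemxAl We scaler0 sub0r.
  by rewrite /v /a !mulmxA WP.
have aWa : a^t* *m v = ((rdot a v)%:C)%:M.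
  rewrite [LHS]mx11_scalar; congr (_%:M); rewrite /rdot.
  apply: (@herm_diag_real _ 1 (a^t* *m v) 0).
  by rewrite adjmxM adjmxK vE -mulmxA.
have uMP : u^t* *m ((t%:C)%:M - H) *m P = 0.
  rewrite uE !mulmxDl -!mulmxA [W *m (_ *m _)]mulmxA WR.
  rewrite mulmxBl mulmxBr mul_scalar_mx -scalemxAr eP scaler0 sub0r.
  by rewrite aE -!mulmxA proj_id addNr.
have uMe : u^t* *m ((t%:C)%:M - H) *m e = (s%:C)%:M.
  rewrite uE !mulmxDl -!mulmxA [W *m (_ *m _)]mulmxA WMe mulmxN aWa.
  rewrite mulmxBl mulmxBr mul_scalar_mx -scalemxAr ee mulmxA eHe subr0.
  by rewrite scalemx1 /s rmorphB raddfB.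
exists (W + s^-1%:C *: (u *m u^t*)); split; first split.
- by apply: psdD pW _; apply: psdZ; [rewrite invr_ge0 ltW | exact: psd_gram].
- rewrite projU1 // -/P -/e mulmxDl !mulmxDr PW -!scalemxAr.
  have -> : P *m (u *m u^t*) = v *m u^t*.
    by rewrite mulmxA uD mulmxDr Pe add0r /v [P *m (_ *m _)]mulmxA PW.
  have -> : e *m e^t* *m W = 0.
    by rewrite -pW.1 -mulmxA -adjmxM We trmx0 map_mx0 mulmx0.
  have -> : e *m e^t* *m (u *m u^t*) = e *m u^t*.
    rewrite !mulmxA -[e *m e^t* *m u]mulmxA uD mulmxDr ee.
    have -> : e^t* *m v = 0 by rewrite /v mulmxA -pW.1 -adjmxM We trmx0 map_mx0 mul0mx.
    by rewrite addr0 mulmx1.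
  by rewrite add0r -addrA -scalerDr -mulmxDl [v + e]addrC -uD.
- rewrite projU1 // -/P -/e; set M := _ - H in WR WMe uMP uMe *.
  have -> : (W + s^-1%:C *: (u *m u^t*)) *m M *m (P + e *m e^t*) =
      W *m M *m P + s^-1%:C *: (u *m (u^t* *m M *m P))
      + (W *m M *m e *m e^t* + s^-1%:C *: (u *m (u^t* *m M *m e) *m e^t*)).
    by rewrite mulmxDl -scalemxAl mulmxDr !mulmxDl -!scalemxAl !mulmxA.
  rewrite WR WMe uMP uMe mulmx0 scaler0 addr0; congr (_ + _).
  rewrite mul_mx_scalar -scalemxAl scalerA -rmorphM mulVf ?gt_eqF //.
  by rewrite rmorph1 scale1r mulNmx uD mulmxDl addrCA addNr addr0.
rewrite retrD retrZ mulrC; congr (_ + _ / _).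
have -> : retr (u *m u^t*) = rdot u u by rewrite /retr mxtrace_mulC /mxtrace big_ord1.
rewrite uD rdotDl !rdotDr (rdotC v e).
have -> : rdot e v = 0 by rewrite rdotC rdotMl pW.1 We rdot0r.
by rewrite {1}/rdot ee mxE /= addr0 add0r.
Qed.

Lemma psd_add1_unit W : psd W -> 1%:M + W \in unitmx.
Proof.
move=> pW; rewrite -row_free_unit; apply: inj_row_free => v v0.
have hM : (1%:M + W)^t* = 1%:M + W by rewrite adjmxD adjmx1 pW.1.
have : (1%:M + W) *m v^t* = 0 by rewrite -hM -adjmxM v0 trmx0 map_mx0.
move=> /(congr1 (rdot (v^t*))); rewrite rdot0r mulmxDl mul1mx rdotDr => E.
have := pW.2 (v^t*); have := rdotxx_ge0 (v^t*) => h1 h2.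
have /rdotxx_eq0 v1 : rdot (v^t*) (v^t*) = 0 by move: E h1 h2; clear; lra.
by rewrite -[v]adjmxK v1 trmx0 map_mx0.
Qed.

(** The new resolvent is [W' = (1 + d W)^-1 W]. The resolvent identity [W = W'
    + d W' W], used a second time for the last factor, gives [W - W' = d W'^2
    + d^2 W' W W'], whose last term has nonnegative trace. *)
Lemma resolvent_shift H S t d W : 0 <= d -> resolvent H S t W ->
  exists W', resolvent H S (t + d) W' /\
    retr W' + d * retr (W' *m W') <= retr W.
Proof.
move=> d0 cert; have WP := resolvent_projr cert; case: cert => pW PW WR.
have pdW := psdZ d0 pW; have U := psd_add1_unit pdW.
set M := 1%:M + d%:C *: W in U; set Z := invmx M.
have ZM : Z *m M = 1%:M by rewrite mulVmx.
have MZ : M *m Z = 1%:M by rewrite mulmxV.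
have hM : M^t* = M by rewrite adjmxD adjmx1 pdW.1.
have hZ : Z^t* = Z.
  by rewrite -[LHS]mulmx1 -MZ mulmxA -{1}hM -adjmxM MZ adjmx1 mul1mx.
have WM : W *m M = M *m W.
  by rewrite mulmxDr mulmxDl mulmx1 mul1mx -scalemxAr -scalemxAl.
have WZ : W *m Z = Z *m W.
  by rewrite -[W *m Z]mul1mx -ZM -!mulmxA [M *m (W *m Z)]mulmxA -WM -mulmxA MZ mulmx1.
have ZWE : Z *m W = Z *m W *m Z + d%:C *: (Z *m (W *m W) *m Z).
  rewrite -{1}[Z *m W]mulmx1 -MZ mulmxA [Z *m W *m M]mulmxDr mulmx1 mulmxDl.
  by rewrite -scalemxAr -scalemxAl !mulmxA.
have pZW : psd (Z *m W).
  rewrite ZWE -{1 3}hZ; apply: psdD; first exact: psd_conj.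
  by apply: psdZ d0 _; apply: psd_conj; apply: psd_sqr pW.1.
exists (Z *m W); split; first split=> //.
- by rewrite -WZ mulmxA PW.
- rewrite -[RHS]mul1mx -ZM -!mulmxA; congr (Z *m _).
  rewrite rmorphD raddfD /= addrAC mulmxDl mulmxDr [W *m (_ *m _)]mulmxA WR.
  by rewrite mulmxDl mul1mx mul_scalar_mx -scalemxAr -scalemxAl.
have WE : W = Z *m W + d%:C *: (Z *m W *m W).
  by rewrite -{1}[W]mul1mx -ZM -[Z *m M *m W]mulmxA [M *m W]mulmxDl mul1mx mulmxDr -scalemxAl -scalemxAr mulmxA.
rewrite {4}WE retrD retrZ lerD2l ler_wpM2l //.
have -> : Z *m W *m W = Z *m W *m (Z *m W) + d%:C *: (Z *m W *m (W *m (Z *m W))).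
  have <- : Z *m W *m W = W *m (Z *m W) by rewrite [RHS]mulmxA WZ.
  by rewrite scalemxAr -mulmxDr -WE.
rewrite retrD retrZ lerDl mulr_ge0 // mulmxA.
by have := retr_psd_ge0 (psd_conj (Z *m W) pW); rewrite pZW.1 mulmxA.
Qed.

End Resolvent.

(** * Greedy selection of indices *)

Section Greedy.
Variables (R : realType) (m : nat).
Local Notation C := R[i].
Implicit Types (H W M : 'M[C]_m) (S T : {set 'I_m}).

(** Summing over all [i] gives the trace of [H W H], that is of [W H^2], and
    [H^2 <= 1]. *)
Lemma sum_rdot_column_le H S T W : H^t* = H -> opbound 1 H -> psd W ->
  proj R S *m W = W ->
  \sum_(i in T) rdot (proj R S *m H *m basis R i) (W *m (proj R S *m H *m basis R i))
    <= retr W.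
Proof.
move=> hH H1 pW PW.
have WP : W *m proj R S = W by rewrite -pW.1 -[in RHS]PW adjmxM adj_proj.
pose F i := rdot (proj R S *m H *m basis R i) (W *m (proj R S *m H *m basis R i)).
rewrite (eq_bigr F) //.
have F0 i : 0 <= F i by exact: pW.2.
apply: (@le_trans _ _ (\sum_i F i)).
  by rewrite [leRHS](bigID (mem T)) /= lerDl sumr_ge0.
have -> : \sum_i F i = retr (W *m (H *m H)).
  rewrite mulmxA retrC mulmxA retrE; apply: eq_bigr => i _; rewrite /F.
  rewrite -[proj R S *m H *m _]mulmxA rdotMl adj_proj !mulmxA PW WP.
  by rewrite -!mulmxA rdotMl hH.
have pK : psd (1%:M - H *m H).
  split=> [|x]; first by rewrite adjmxB adjmx1 adjmxM hH.
  rewrite mulmxBl mul1mx rdotDr rdotNr subr_ge0 -mulmxA -{1}hH -rdotMl.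
  by have := opbound_rdot x H1; rewrite expr1n mul1r.
by have := retr_psdM_ge0 pW pK; rewrite mulmxBr mulmx1 retrD retrN subr_ge0.
Qed.

Lemma exists_lt1 T (G : 'I_m -> R) : \sum_(i in T) G i < #|T|%:R ->
  exists2 i, i \in T & G i < 1.
Proof.
move=> GT; apply: contrapT => noi; move: GT; apply/negP; rewrite -leNgt.
rewrite -sum1_card natr_sum; apply: ler_sum => i iT; rewrite leNgt.
by apply/negP => Gi; apply: noi; exists i.
Qed.

Lemma barrier_step (tau t c d phi v psi p q : R) :
  0 < tau -> tau <= t -> 0 < c -> c <= 1 -> 0 <= d -> d = 2 * c / tau ->
  0 <= psi -> 0 <= q -> p * (2 / tau) <= 1 -> q / (c * (psi + 1)) <= 1 ->
  v + d * psi <= phi ->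
  0 < t + d - p /\ v + (1 + q) / (t + d - p) <= phi + 4 / tau.
Proof.
move=> tau0 taut c0 c1 d0 dE psi0 q0 tp tq vphi.
have ple : p <= tau / 2 by move: tp; rewrite mulrA ler_pdivrMr //; lra.
have qle : q <= c * (psi + 1).
  by move: tq; rewrite ler_pdivrMr ?mul1r // mulr_gt0 // ltr_wpDl.
have s0 : 0 < t + d - p by lra.
split=> //; apply: (@le_trans _ _ (v + (1 + c * (psi + 1)) * (2 / tau))).
  rewrite lerD2l ler_pdivrMr // -mulrA; apply: (@le_trans _ _ (1 + c * (psi + 1))).
    by rewrite lerD2l.
  apply: ler_peMr; first by rewrite addr_ge0 // (le_trans q0).
  by rewrite -mulrA mulrCA ler_pdivlMl //; lra.
have -> : (1 + c * (psi + 1)) * (2 / tau) = d * psi + (1 + c) * (2 / tau).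
  by rewrite dE; ring.
have -> : 4 / tau = 2 * (2 / tau) by ring.
rewrite addrA lerD // ler_wpM2r ?divr_ge0 //; last by lra.
exact: ltW.
Qed.

(** Let [W_l'] be the resolvents after raising the level by [d = 2 c / tau],
    where [c = 4 |I| / r], and let [a] be the column of a candidate index [i].
    Averaged over [T], the quantities [Re <W_l' a, a>] and [|W_l' a|^2] are at
    most the traces of [W_l'] and of [W_l'^2], divided by the size of [T]. So
    a single [i] keeps all the Schur complements above [tau / 2] and all the
    [|W_l' a|^2] below [c (psi_l + 1)], where [psi_l] is the trace of
    [W_l'^2]. The increase [(2 / tau) c psi_l] that the latter causes is then
    absorbed by the decrease [d psi_l] due to the shift. *)
Lemma greedy_step (I : finType) (H : I -> 'M[C]_m) S T (W : I -> 'M[C]_m)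
    (tau t phi r : R) :
  (forall l, (H l)^t* = H l) -> (forall l i, H l i i = 0) ->
  (forall l, opbound 1 (H l)) -> (0 < #|I|)%N ->
  0 < tau -> tau <= t -> 4 * #|I|%:R <= r -> r <= 2 * #|T|%:R ->
  16 * #|I|%:R * phi <= tau * r ->
  (forall i, i \in T -> i \notin S) ->
  (forall l, resolvent (H l) S t (W l) /\ retr (W l) <= phi) ->
  exists2 i, i \in T & exists W' : I -> 'M[C]_m,
   forall l, resolvent (H l) (i |: S) (t + 8 * #|I|%:R / (r * tau)) (W' l)
    /\ retr (W' l) <= phi + 4 / tau.
Proof.
move=> hH H0 H1 I0 tau0 taut hr rT phir TS HW.
set h : R := #|I|%:R in hr phir *.
have h0 : 0 < h by rewrite ltr0n.
have r0 : 0 < r by lra.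
have [c cE] : exists c, c = 4 * h / r by exists (4 * h / r).
have c0 : 0 < c by rewrite cE divr_gt0 ?mulr_gt0.
have c1 : c <= 1 by rewrite cE ler_pdivrMr // mul1r.
have -> : 8 * h / (r * tau) = 2 * c / tau.
  by rewrite cE; field; rewrite !gt_eqF.
set d := 2 * c / tau; have d0 : 0 <= d by rewrite divr_ge0 ?mulr_ge0 // ltW.
have dE : d = 2 * c / tau by []; clearbody d.
have /choice [V HV] l := resolvent_shift d0 (HW l).1.
pose a l i := proj R S *m H l *m basis R i.
pose p l i := rdot (a l i) (V l *m a l i).
pose q l i := rdot (V l *m a l i) (V l *m a l i).
pose psi l := retr (V l *m V l).
have psi0 l : 0 <= psi l.
  by apply/retr_psd_ge0/psd_sqr; have [[[]]] := HV l.
have p0 l i : 0 <= p l i by have [[[_ pV] _ _] _] := HV l; apply: pV.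
have q0 l i : 0 <= q l i by exact: rdotxx_ge0.
have sp l : \sum_(i in T) p l i <= phi.
  have [[pV PV _] tV] := HV l; apply: le_trans (HW l).2; apply: le_trans tV.
  apply: le_trans (sum_rdot_column_le T (hH l) (H1 l) pV PV) _.
  by rewrite lerDl mulr_ge0 //; exact: psi0.
have sq l : \sum_(i in T) q l i <= psi l.
  have [[pV PV _] tV] := HV l.
  have PVV : proj R S *m (V l *m V l) = V l *m V l by rewrite mulmxA PV.
  apply: le_trans (sum_rdot_column_le T (hH l) (H1 l) (psd_sqr pV.1) PVV).
  by apply: ler_sum => i _; rewrite /q rdotMl pV.1 -[V l *m V l *m _]mulmxA.
(* The summand 1 keeps the denominator positive even if [psi l] vanishes. *)
pose G i := \sum_l (p l i * (2 / tau) + q l i / (c * (psi l + 1))).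
have psi1 l : 0 < c * (psi l + 1) by rewrite mulr_gt0 // ltr_wpDl.
have GT : \sum_(i in T) G i < #|T|%:R.
  rewrite exchange_big /=.
  apply: (@le_lt_trans _ _ (\sum_(l : I) (phi * (2 / tau) + c^-1))).
    apply: ler_sum => l _; rewrite big_split /= -!mulr_suml; apply: lerD.
      by rewrite ler_wpM2r // divr_ge0 // ltW.
    rewrite (ler_pdivrMr _ _ (psi1 l)) mulrA mulVf ?(gt_eqF c0) // mul1r.
    by apply: le_trans (sq l) _; rewrite lerDl.
  rewrite sumr_const -[_ *+ _]mulr_natl -/h.
  have -> : h * (phi * (2 / tau) + c^-1) = (h * phi * 2) / tau + r / 4.
    by rewrite cE; field; rewrite !gt_eqF.
  have : h * phi * 2 / tau <= r / 8.
    by rewrite ler_pdivrMr //; move: phir; clear; lra.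
  by move: rT r0; clear; lra.
have [i iT Gi] := exists_lt1 GT; exists i => //.
have terms l : p l i * (2 / tau) <= 1 /\ q l i / (c * (psi l + 1)) <= 1.
  have t1 l' : 0 <= p l' i * (2 / tau) by apply: mulr_ge0; rewrite ?p0 // divr_ge0 // ltW.
  have t2 l' : 0 <= q l' i / (c * (psi l' + 1)) by rewrite divr_ge0 ?q0 // ltW ?psi1.
  have : p l i * (2 / tau) + q l i / (c * (psi l + 1)) <= 1.
    apply: le_trans (ltW Gi); rewrite /G (bigD1 l) //= lerDl sumr_ge0 // => l' _.
    exact: addr_ge0 (t1 l') (t2 l').
  by move=> le1; split; apply: le_trans le1; [rewrite lerDl t2 | rewrite lerDr t1].
suff /choice [W' HW'] l : exists W' : 'M[C]_m,
  resolvent (H l) (i |: S) (t + d) W' /\ retr W' <= phi + 4 / tau by exists W'.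
have [tp tq] := terms l; have [cV tV] := HV l.
have [s0 le4] := barrier_step tau0 taut c0 c1 d0 dE (psi0 l) (q0 l i) tp tq
  (le_trans tV (HW l).2).
have [W' [cW' tW']] := resolvent_extend (hH l) (H0 l i) (TS i iT) cV s0.
by exists W'; split=> //; rewrite tW'.
Qed.

(** Start from the empty set at level [tau] and iterate [greedy_step]. After
    [j] steps the traces are at most [4 j / tau], and the level has been
    raised by [8 |I| j / (r tau)], which stays below [tau]; the hypothesis on
    [k] is what the averaging needs. *)
Lemma greedy_resolvents (I : finType) (H : I -> 'M[C]_m) S (tau : R) (k : nat) :
  (forall l, (H l)^t* = H l) -> (forall l i, H l i i = 0) ->
  (forall l, opbound 1 (H l)) -> (0 < #|I|)%N -> 0 < tau ->
  (4 * #|I| <= #|S|)%N -> (2 * k <= #|S|)%N ->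
  64 * #|I|%:R * k%:R <= tau ^+ 2 * #|S|%:R ->
  exists sigma : {set 'I_m}, [/\ sigma \subset S, #|sigma| = k &
    exists W : I -> 'M[C]_m, forall l, resolvent (H l) sigma (tau + tau) (W l)].
Proof.
move=> hH H0 H1 I0 tau0 IS kS ktau.
have S0 : (0 < #|S|)%N by apply: leq_trans IS; rewrite muln_gt0.
have r0 : (0 : R) < #|S|%:R by rewrite ltr0n.
have h0 : (0 : R) < #|I|%:R by rewrite ltr0n.
pose d : R := 8 * #|I|%:R / (#|S|%:R * tau).
have d0 : 0 <= d by rewrite divr_ge0 ?mulr_ge0 // ltW.
suff step j : (j <= k)%N -> exists sigma : {set 'I_m}, [/\ sigma \subset S, #|sigma| = j &
    exists W : I -> 'M[C]_m, forall l, resolvent (H l) sigma (tau + j%:R * d) (W l)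
      /\ retr (W l) <= j%:R * (4 / tau)].
  have [sigma [sS sk [W HW]]] := step k (leqnn k).
  exists sigma; split=> //.
  (* A last shift brings the level to exactly [2 tau]. *)
  have e0 : 0 <= tau - k%:R * d.
    rewrite /d subr_ge0 mulrA ler_pdivrMr ?mulr_gt0 //.
    have := ler0n R k; nra.
  have /choice [V HV] l := resolvent_shift e0 (HW l).1.
  exists V => l; have [+ _] := HV l; congr (resolvent _ _ _ _).
  by rewrite -addrA; congr (_ + _); rewrite addrC subrK.
elim: j => [_|j IH jk].
  exists finset.set0; split; rewrite ?finset.sub0set ?cards0 //.
  exists (fun=> 0) => l; rewrite !mul0r addr0; split; first exact: resolvent0.
  by rewrite /retr mxtrace0.
have [sigma [sS sj [W HW]]] := IH (ltnW jk).
have cT : #|(S :\: sigma)%SET| = (#|S| - j)%N.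
  by rewrite cardsD (finset.setIidPr sS) sj.
have jS : (j <= #|S|)%N by rewrite -sj subset_leq_card.
have jk' : j.+1%:R <= k%:R :> R by rewrite ler_nat.
have [||||i|i iT [W' HW']] := greedy_step (T := (S :\: sigma)%SET)
    (t := tau + j%:R * d) (r := #|S|%:R) hH H0 H1 I0 tau0 _ _ _ _ _ HW.
- by rewrite lerDl mulr_ge0.
- by rewrite -natrM ler_nat.
- rewrite cT -natrM ler_nat; lia.
- have -> : 16 * #|I|%:R * (j%:R * (4 / tau)) = (64 * #|I|%:R * j%:R) / tau by ring.
  rewrite ler_pdivrMr // [leRHS]mulrAC -expr2; apply: le_trans ktau.
  by rewrite ler_wpM2l ?mulr_ge0 ?ler_nat // ltnW.
- by rewrite finset.inE => /andP[].
move: iT; rewrite finset.inE => /andP[isig iS].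
exists (i |: sigma)%SET; split.
- by rewrite finset.subUset finset.sub1set iS.
- by rewrite cardsU1 isig sj.
exists W' => l; have [cW tW] := HW' l; split.
  by move: cW; rewrite -/d -addrA -[j.+1]addn1 natrD mulrDl mul1r.
by rewrite -[j.+1]addn1 natrD mulrDl mul1r.
Qed.

End Greedy.

(** * Principal submatrices of small norm *)

Section SmallCompression.
Variables (R : realType) (m : nat).
Local Notation C := R[i].
Implicit Types (A B P Q : 'M[C]_m) (S T : {set 'I_m}).

Definition compress S A := proj R S *m A *m proj R S.

Lemma opbound_compress a S A : opbound a A -> opbound a (compress S A).
Proof.
move=> aA; have := opboundM (opboundM (opbound_proj R S) aA) (opbound_proj R S).
by rewrite mul1r mulr1.
Qed.

Lemma compressE S A i j :
  compress S A i j = if (i \in S) && (j \in S) then A i j else 0.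
Proof.
rewrite mul_projE proj_mulE; case: (i \in S); case: (j \in S);
by rewrite ?mul1r ?mulr1 ?mul0r ?mulr0.
Qed.

Lemma compressD S A B : compress S (A + B) = compress S A + compress S B.
Proof. by rewrite /compress mulmxDr mulmxDl. Qed.

Lemma compressZ S c A : compress S (c *: A) = c *: compress S A.
Proof. by rewrite /compress -scalemxAr -scalemxAl. Qed.

(** [- c P <= Q <= c P] implies [Q^2 <= c^2 P]: twice [c (c^2 P - Q^2)] equals
    [(cP + Q)(cP - Q)(cP + Q) + (cP - Q)(cP + Q)(cP - Q)], a sum of two
    positive semidefinite matrices. *)
Lemma psd_opbound c P Q : 0 < c -> P^t* = P -> P *m P = P -> opbound 1 P ->
  Q^t* = Q -> P *m Q = Q -> Q *m P = Q ->
  psd (c%:C *: P - Q) -> psd (c%:C *: P + Q) -> opbound c Q.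
Proof.
move=> c0 hP PP P1 hQ PQ QP pB pD.
pose E := (c ^+ 2)%:C *: P - Q *m Q.
have BD : (c%:C *: P - Q) *m (c%:C *: P + Q) = E.
  rewrite mulmxBl !mulmxDr -!scalemxAr -!scalemxAl PP PQ QP scalerA -rmorphM.
  by rewrite opprD addrA addrK.
have DB : (c%:C *: P + Q) *m (c%:C *: P - Q) = E.
  rewrite mulmxDl !mulmxBr -!scalemxAr -!scalemxAl PP PQ QP scalerA -rmorphM.
  by rewrite addrA subrK.
have EP : E *m P = E by rewrite mulmxBl -scalemxAl PP -mulmxA QP.
(* [E] is the product of [c P - Q] and [c P + Q], in either order. *)
have pE2 : psd ((2 * c)%:C *: E).
  have -> : (2 * c)%:C *: E =
      (c%:C *: P + Q) *m (c%:C *: P - Q) *m (c%:C *: P + Q)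
      + (c%:C *: P - Q) *m (c%:C *: P + Q) *m (c%:C *: P - Q).
    rewrite DB BD -mulmxDr addrACA subrr addr0 -scalerDl -scalemxAr EP.
    by rewrite -rmorphD /= -mulr2n mulr_natl.
  by apply: psdD; [rewrite -{1}pD.1 | rewrite -{1}pB.1]; apply: psd_conj.
apply: opbound_sqr => [|x]; first exact: ltW.
have := pE2.2 x; rewrite -scalemxAl rdotZr pmulr_rge0 ?mulr_gt0 //.
rewrite mulmxBl rdotDr rdotNr -scalemxAl rdotZr -mulmxA -{1}hQ -rdotMl subr_ge0.
move=> H; apply: le_trans H _; rewrite ler_wpM2l ?sqr_ge0 //.
rewrite -PP -mulmxA -{1}hP -rdotMl.
by have := opbound_rdot x P1; rewrite expr1n mul1r.
Qed.

Definition rpart A : 'M[C]_m := (2^-1)%:C *: (A + A^t*).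
Definition ipart A : 'M[C]_m := (- 'i * (2^-1)%:C) *: (A - A^t*).

Lemma rpart_herm A : (rpart A)^t* = rpart A.
Proof. by rewrite adjmxZ adjmxD adjmxK conjC_real addrC. Qed.

Lemma ipart_herm A : (ipart A)^t* = ipart A.
Proof.
rewrite adjmxZ adjmxB adjmxK -opprB scalerN -scaleNr; congr (_ *: _).
by rewrite conjC_conjc; apply/eqP; rewrite eq_complex /=; apply/andP; split; apply/eqP; ring.
Qed.

Lemma rpart_ipart A : A = rpart A + 'i *: ipart A.
Proof.
rewrite /rpart /ipart scalerA mulrA mulrN -expr2 sqr_i opprK mul1r -scalerDr.
rewrite addrACA subrr addr0 scalerDr -scalerDl -rmorphD.
have -> : 2^-1 + 2^-1 = 1 :> R by field.
by rewrite rmorph1 scale1r.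
Qed.

Lemma rpart_opbound A : opbound 1 A -> opbound 1 (rpart A).
Proof.
move=> A1; have := opboundZ (2^-1)%:C (opboundD A1 (opbound_adj A1)).
by rewrite normcZ ger0_norm ?invr_ge0 // -mulr2n mulVf ?pnatr_eq0.
Qed.

Lemma ipart_opbound A : opbound 1 A -> opbound 1 (ipart A).
Proof.
move=> A1; have := opboundZ (- 'i * (2^-1)%:C) (opboundB A1 (opbound_adj A1)).
rewrite Normc.normcM normcZ.
have -> : Normc.normc (- 'i : C) = 1 by rewrite /= oppr0 expr0n /= add0r sqrrN expr1n sqrtr1.
by rewrite mul1r ger0_norm ?invr_ge0 // -mulr2n mulVf ?pnatr_eq0.
Qed.

(** The greedy selection is applied to the four matrices [+- Re A] and [+- Im
    A]; it bounds the real and the imaginary parts of the compression by [2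
    tau] each. *)
Lemma small_compression_unit A S (tau : R) k :
  zero_diagonal A -> opbound 1 A -> 0 < tau ->
  (16 <= #|S|)%N -> (2 * k <= #|S|)%N -> 256 * k%:R <= tau ^+ 2 * #|S|%:R ->
  exists sigma : {set 'I_m}, [/\ sigma \subset S, #|sigma| = k &
    opbound (4 * tau) (compress sigma A)].
Proof.
move=> A0 A1 tau0 S16 kS ktau.
pose B (b : bool) := if b then rpart A else ipart A.
pose H (l : bool * bool) := if l.1 then B l.2 else - B l.2.
have hB b : (B b)^t* = B b by case: b; [apply: rpart_herm | apply: ipart_herm].
have B1 b : opbound 1 (B b) by case: b; [apply: rpart_opbound | apply: ipart_opbound].
have B0 b i : B b i i = 0 by case: b; rewrite !mxE A0 conjC0 ?oppr0 addr0 mulr0.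
have hH l : (H l)^t* = H l by case: l => [[] b]; rewrite /H /= ?linearN ?map_mxN /= hB.
have H0 l i : H l i i = 0 by case: l => [[] b]; rewrite /H /= ?mxE B0 ?oppr0.
have H1 l : opbound 1 (H l) by case: l => [[] b]; [|apply: opboundN]; apply: B1.
have cI : #|{: bool * bool}| = 4%N by rewrite card_prod card_bool.
have [||||sigma [sS sk [W HW]]] := @greedy_resolvents R m _ H S tau k hH H0 H1 _ tau0.
- by rewrite cI.
- by rewrite cI.
- by [].
- by rewrite cI -natrM.
exists sigma; split=> //.
have bB b : opbound (tau + tau) (compress sigma (B b)).
  have := resolvent_psd (hH (true, b)) (HW (true, b)).
  have := resolvent_psd (hH (false, b)) (HW (false, b)).
  rewrite /H /= opprK mulmxDr mulmxBr mulmxDl mulmxBl mul_mx_scalar -scalemxAl proj_id.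
  move=> pD pB; apply: psd_opbound pB pD; rewrite ?addr_gt0 //.
  - exact: adj_proj.
  - exact: proj_id.
  - exact: opbound_proj.
  - by rewrite !adjmxM adj_proj hB mulmxA.
  - by rewrite !mulmxA proj_id.
  - by rewrite -!mulmxA proj_id.
have := opboundD (bB true) (opboundZ 'i (bB false)).
have -> : Normc.normc ('i : C) = 1 by rewrite /= expr0n /= add0r expr1n sqrtr1.
have <- : tau + tau + (tau + tau) = 4 * tau by ring.
by rewrite mul1r -compressZ -compressD /B -rpart_ipart.
Qed.

Lemma small_compression A a S (tau : R) k :
  zero_diagonal A -> opbound a A -> 0 < tau ->
  (16 <= #|S|)%N -> (2 * k <= #|S|)%N -> 256 * k%:R <= tau ^+ 2 * #|S|%:R ->
  exists sigma : {set 'I_m}, [/\ sigma \subset S, #|sigma| = k &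
    opbound (4 * tau * a) (compress sigma A)].
Proof.
move=> A0 aA tau0 S16 kS ktau; have [a0|a0] := eqVneq a 0.
  have A1 : opbound 1 A by apply: opbound_le aA; rewrite a0.
  have [sigma [sS sk _]] := small_compression_unit A0 A1 tau0 S16 kS ktau.
  exists sigma; split=> //; rewrite a0 mulr0 -[X in opbound X]a0.
  exact: opbound_compress.
have pa : 0 < a by rewrite lt_def a0 aA.1.
have A0' : zero_diagonal (a^-1%:C *: A) by move=> i; rewrite mxE A0 mulr0.
have A1 : opbound 1 (a^-1%:C *: A).
  by have := opboundZ a^-1%:C aA; rewrite normcZ ger0_norm ?invr_ge0 ?ltW // mulVf.
have [sigma [sS sk bs]] := small_compression_unit A0' A1 tau0 S16 kS ktau.
exists sigma; split=> //; have := opboundZ a%:C bs.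
rewrite normcZ gtr0_norm // mulrC compressZ scalerA -rmorphM.
by rewrite (divff a0) rmorph1 scale1r.
Qed.

(** The choice [tau = 32 / 2 ^ L] makes [tau ^ 2] equal to [1024 / 4 ^ L], so
    that about a fraction [4 ^ - L] of the indices can be selected. *)
Lemma small_compression_pow A a S L :
  zero_diagonal A -> opbound a A -> (2 <= L)%N -> (4 ^ L <= #|S|)%N ->
  exists sigma : {set 'I_m}, [/\ sigma \subset S, (#|sigma| * 4 ^ L <= 2 * #|S|)%N,
    (#|S| < #|sigma| * 4 ^ L)%N & opbound (128 / 2 ^+ L * a) (compress sigma A)].
Proof.
move=> A0 aA L2 LS; set N := (4 ^ L)%N in LS *.
have N16 : (16 <= N)%N by rewrite -[16%N]/(4 ^ 2)%N leq_pexp2l.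
(* Rounding up makes the remainder decrease by the full factor. *)
pose k := (#|S| %/ N).+1.
have kN : (#|S| < k * N)%N by rewrite -ltn_divLR //; lia.
have kN2 : (k * N <= 2 * #|S|)%N.
  by rewrite mulSn; have := leq_divM #|S| N; lia.
have p2 : (0 : R) < 2 ^+ L by rewrite exprn_gt0.
have [||||sigma [sS sk bs]] := @small_compression A a S (32 / 2 ^+ L) k A0 aA.
- by rewrite divr_gt0.
- by lia.
- nia.
- have N0 : (0 : R) < N%:R by rewrite ltr0n; lia.
  have NE : (2 ^+ L) ^+ 2 = N%:R :> R by rewrite -exprM mulnC exprM natrX -natrX.
  rewrite expr_div_n NE mulrAC ler_pdivlMr // -mulrA -natrM.
  have : (k * N)%:R <= (2 * #|S|)%:R :> R by rewrite ler_nat.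
  by rewrite (natrM _ 2); have := ler0n R #|S|; lra.
exists sigma; split; rewrite ?sk //.
by have -> : 128 / 2 ^+ L = 4 * (32 / 2 ^+ L) :> R by ring.
Qed.

(** The sets are extracted one after the other from what remains. Each
    extraction multiplies the size of the remainder [T] by at most [1 - 4 ^ -
    L], unless the remainder is already smaller than [4 ^ L]. The value [g p]
    is the step at which [p] is extracted. *)
Lemma extract_small_compressions A a S L J :
  zero_diagonal A -> opbound a A -> (2 <= L)%N ->
  exists (T : {set 'I_m}) (g : 'I_m -> nat),
    [/\ T \subset S, forall p, p \in (S :\: T)%SET -> (g p < J)%N,
      forall j, let sigma := [set p in (S :\: T)%SET | g p == j]%SET in
        (#|sigma| * 4 ^ L <= 2 * #|S|)%N /\
        opbound (128 / 2 ^+ L * a) (compress sigma A) &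
      (#|T| < 4 ^ L)%N \/ (#|T| * (4 ^ L) ^ J <= #|S| * (4 ^ L).-1 ^ J)%N].
Proof.
move=> A0 aA L2; have eps0 : 0 <= 128 / 2 ^+ L * a.
  by rewrite mulr_ge0 ?aA.1 // divr_ge0 // exprn_ge0.
have empty : opbound (128 / 2 ^+ L * a) (compress finset.set0 A).
  apply: opbound_le eps0 _; have -> : compress finset.set0 A = 0.
    by apply/matrixP => i j; rewrite compressE finset.in_set0 mxE.
  exact: opbound0.
elim: J => [|J [T [g [TS gJ cls dec]]]].
  exists S, (fun=> 0%N); split; first exact: fintype.subxx.
  - by move=> p; rewrite finset.setDv finset.in_set0.
  - move=> j /=; have -> : [set p in S :\: S | 0%N == j]%SET = finset.set0.
      by apply/setP => p; rewrite !finset.inE; case: (p \in S).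
    by rewrite cards0.
  - by right; rewrite !expn0.
have [TN|TN] := ltnP #|T| (4 ^ L).
  exists T, g; split=> //; last by left.
  by move=> p /gJ; apply: ltnW.
have [sigma [sT sN Ns bs]] := small_compression_pow A0 aA L2 TN.
have TS' := subset_leq_card TS.
exists (T :\: sigma)%SET, (fun p => if p \in sigma then J else g p); split.
- exact: fintype.subset_trans (subsetDl _ _) TS.
- move=> p; rewrite !finset.inE; case: ifP => [_ //|ps] /andP[/= pT pS].
  by apply/ltnW/gJ; rewrite finset.inE pT.
- move=> j; have [->|jJ] /= := eqVneq j J.
    have -> : [set p in S :\: (T :\: sigma) | (if p \in sigma then J else g p) == J]%SET = sigma.
      apply/setP => p; rewrite !finset.inE.
      have [ps|ps] /= := boolP (p \in sigma).
        by rewrite eqxx andbT (fintype.subsetP TS) // (fintype.subsetP sT).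
      apply/negP => /andP[/andP[pT pS] /eqP gp].
      by have := gJ p; rewrite finset.inE pT pS gp ltnn => /(_ isT).
    by split=> //; apply: leq_trans sN _; rewrite leq_mul2l TS'.
  have -> : [set p in S :\: (T :\: sigma) | (if p \in sigma then J else g p) == j]%SET
      = [set p in S :\: T | g p == j]%SET.
    apply/setP => p; rewrite !finset.inE.
    have [ps|ps] //= := boolP (p \in sigma).
    by rewrite (fintype.subsetP sT) // [J == j]eq_sym (negPf jJ) andbF.
  exact: cls.
right; have cD : #|(T :\: sigma)%SET| = (#|T| - #|sigma|)%N.
  by rewrite cardsD (finset.setIidPr sT).
case: dec => [|dec]; first by rewrite ltnNge TN.
rewrite cD !expnS mulnA.
have N0 : (0 < 4 ^ L)%N by rewrite expn_gt0.
set N := (4 ^ L)%N in N0 sN Ns dec *.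
have H1 : ((#|T| - #|sigma|) * N <= #|T| * N.-1)%N.
  by rewrite mulnBl -subn1 mulnBr muln1 leq_sub2l // ltnW.
apply: (@leq_trans (#|T| * N.-1 * N ^ J)); first by rewrite leq_mul2r H1 orbT.
by rewrite mulnAC mulnC [(#|S| * _)%N]mulnCA leq_mul2l dec orbT.
Qed.

Lemma expn_pred_le N : (0 < N)%N -> (2 * N.-1 ^ N <= N ^ N)%N.
Proof.
case: N => // N _ /=.
have bern n : (N ^ n.+1 + n.+1 * N ^ n <= N.+1 ^ n.+1)%N.
  elim: n => [|n IH]; first by rewrite !expn1 expn0 muln1 addn1.
  rewrite (expnS N.+1); apply: leq_trans (leq_mul (leqnn N.+1) IH).
  by rewrite !expnS; nia.
apply: leq_trans (bern N); rewrite mul2n -addnn leq_add2l expnS.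
by rewrite leq_mul2r leqnSn orbT.
Qed.

(** Every [4 ^ L] extractions halve the remainder, so [4 ^ L * L] of them
    reduce it by [2 ^ L]. *)
Lemma partition_small_compressions A a S L :
  zero_diagonal A -> opbound a A -> (2 <= L)%N ->
  exists (T : {set 'I_m}) (g : 'I_m -> nat),
    [/\ T \subset S, forall p, p \in (S :\: T)%SET -> (g p < 4 ^ L * L)%N,
      forall j, let sigma := [set p in (S :\: T)%SET | g p == j]%SET in
        (#|sigma| * 4 ^ L <= 2 * #|S|)%N /\
        opbound (128 / 2 ^+ L * a) (compress sigma A) &
      (#|T| < 4 ^ L)%N \/ (#|T| * 2 ^ L <= #|S|)%N].
Proof.
move=> A0 aA L2.
have [T [g [TS gJ cls dec]]] := extract_small_compressions S (4 ^ L * L) A0 aA L2.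
exists T, g; split=> //; case: dec => [|dec]; [by left | right].
have N1 : (1 < 4 ^ L)%N by rewrite -[1%N]/(4 ^ 0)%N ltn_exp2l //; lia.
set N := (4 ^ L)%N in dec N1 *.
have H : (2 ^ L * N.-1 ^ (N * L) <= N ^ (N * L))%N.
  rewrite !expnM -expnMn leq_exp2r //; last by lia.
  by apply: expn_pred_le; lia.
have pos : (0 < N.-1 ^ (N * L))%N by rewrite expn_gt0; lia.
rewrite -(leq_pmul2r pos) -mulnA; apply: leq_trans dec.
by rewrite leq_mul2l H orbT.
Qed.

End SmallCompression.

(** * Gluing commutator representations along a grid *)

Section Grid.
Variables (R : realType) (m : nat).
Local Notation C := R[i].
Implicit Types (A X Y M : 'M[C]_m) (S T : {set 'I_m}) (b : 'I_m -> C).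

Definition dmx b : 'M[C]_m := diag_mx (\row_j b j).

Lemma commutator_dmxE b X i j : commutator (dmx b) X i j = (b i - b j) * X i j.
Proof.
by rewrite /commutator /dmx mul_diag_mx mul_mx_diag !mxE; ring.
Qed.

Lemma abs_Re_le_normc (z : C) : `|complex.Re z| <= Normc.normc z.
Proof. by case: z => x y /=; rewrite -sqrtr_sqr ler_wsqrtr // lerDl sqr_ge0. Qed.

Lemma abs_Im_le_normc (z : C) : `|complex.Im z| <= Normc.normc z.
Proof. by case: z => x y /=; rewrite -sqrtr_sqr ler_wsqrtr // lerDr sqr_ge0. Qed.

Lemma centered_square_normc (z : C) : centered_square z -> Normc.normc z <= 3 / 2.
Proof.
move=> [/andP[x1 x2] /andP[y1 y2]].
rewrite -(ler_pXn2r (n := 2)) ?nnegrE ?normc_nonneg ?divr_ge0 //.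
by rewrite sqr_normcE; nra.
Qed.

Lemma opbound_dmx b l : 0 <= l -> (forall j, Normc.normc (b j) <= l) ->
  opbound l (dmx b).
Proof.
move=> l0 bl; apply: opbound_sqr => // x; rewrite !rdotxx mulr_sumr.
apply: ler_sum => j _; rewrite mul_diag_mx !mxE Normc.normcM exprMn.
by rewrite ler_wpM2r ?sqr_ge0 // ler_pXn2r ?nnegrE ?normc_nonneg.
Qed.

(** Stating the property for subsets of a fixed index type lets the induction
    run without submatrices of varying size. *)
Definition solvable A S l := exists b X,
  [/\ forall j, centered_square (b j), compress S A = commutator (dmx b) X
    & opbound l X].

Lemma solvable_le A S l l' : l <= l' -> solvable A S l -> solvable A S l'.
Proof.
by move=> ll' [b [X [bs E lX]]]; exists b, X; split=> //; apply: opbound_le lX.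
Qed.

Lemma solvable_compress A S l : solvable (compress S A) S l -> solvable A S l.
Proof.
case=> b [X [bs E lX]]; exists b, X; split=> //; rewrite -E.
by apply/matrixP => i j; rewrite !compressE; case: ifP.
Qed.

Lemma solvable_supported A S l : solvable A S l -> exists b X,
  [/\ forall j, centered_square (b j), compress S A = commutator (dmx b) X,
      compress S X = X & opbound l X].
Proof.
move=> [b [X [bs E lX]]]; exists b, (compress S X); split=> //.
- apply/matrixP => i j; rewrite commutator_dmxE [compress S X i j]compressE.
  have := congr1 (fun M : 'M[C]_m => M i j) E; rewrite /= commutator_dmxE compressE.
  by case: ifP => // _ _; rewrite mulr0.
- by apply/matrixP => i j; rewrite !compressE; case: ifP => // ->.
- exact: opbound_compress.
Qed.

(** The blocks act on mutually orthogonal subspaces, so the squared norms add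
    up. *)
Lemma opbound_blocks (J : finType) (col : 'I_m -> J) (X : J -> 'M[C]_m) l :
  0 <= l -> (forall c, opbound l (X c)) ->
  (forall c, compress [set p | col p == c]%SET (X c) = X c) ->
  opbound l (\matrix_(p, q) X (col p) p q).
Proof.
move=> l0 lX cX; apply: opbound_sqr => // x.
set D := \matrix_(p, q) _.
pose P c := proj R [set p | col p == c]%SET : 'M[C]_m.
have DE p : (D *m x) p 0 = (X (col p) *m x) p 0.
  by rewrite !mxE; apply: eq_bigr => q _; rewrite mxE.
have XP c : X c *m x = X c *m (P c *m x).
  have XPc : X c *m P c = X c by rewrite -cX /compress -!mulmxA proj_id.
  by rewrite mulmxA XPc.
apply: (@le_trans _ _ (\sum_c rdot (X c *m x) (X c *m x))).
  rewrite [leLHS]rdotxx; under [leRHS]eq_bigr do rewrite rdotxx.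
  rewrite exchange_big /=; apply: ler_sum => p _; rewrite DE (bigD1 (col p)) //=.
  by rewrite lerDl sumr_ge0 // => c _; rewrite sqr_ge0.
apply: (@le_trans _ _ (\sum_c l ^+ 2 * rdot (P c *m x) (P c *m x))).
  by apply: ler_sum => c _; rewrite XP; apply: opbound_rdot.
rewrite -mulr_sumr ler_wpM2l ?sqr_ge0 // rdotxx.
under eq_bigr do rewrite rdotxx.
rewrite exchange_big /=; apply: ler_sum => p _.
rewrite (bigD1 (col p)) //= big1 ?addr0 => [|c cp].
  by rewrite proj_mulE finset.inE eqxx mul1r.
by rewrite proj_mulE finset.inE eq_sym (negPf cp) mul0r Normc.normc0 expr0n.
Qed.

Lemma sylvesterE (z s : C) b b' M p q :
  (z *: M + s *: (dmx b *m M - M *m dmx b')) p q = (z + s * (b p - b' q)) * M p q.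
Proof. by rewrite /dmx mul_diag_mx mul_mx_diag !mxE; ring. Qed.

(** The equation determines [z M] as a perturbation of [A] by a term of norm
    at most [3 s |M|], because the entries of [b] and [b'] have modulus at
    most [3 / 2]. Hence [d |M| <= |A| + 3 s |M|], and no series expansion of
    the solution is needed. *)
Lemma opbound_sylvester A M a (z : C) (s d : R) b b' :
  (forall j, centered_square (b j)) -> (forall j, centered_square (b' j)) ->
  0 <= s -> d <= Normc.normc z -> 3 * s < d -> opbound a A ->
  A = z *: M + s%:C *: (dmx b *m M - M *m dmx b') ->
  opbound (a / (d - 3 * s)) M.
Proof.
move=> sb sb' s0 dz sd aA AE.
have h2 : 0 <= 3 / 2 :> R by rewrite divr_ge0.
have Bb : opbound (3 / 2) (dmx b).
  by apply: opbound_dmx => // j; apply: centered_square_normc.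
have Bb' : opbound (3 / 2) (dmx b').
  by apply: opbound_dmx => // j; apply: centered_square_normc.
have [mu mM muE] : exists2 mu, opbound mu M & mu = opnorm M.
  by exists (opnorm M) => //; apply: opbound_opnorm.
have mu0 := mM.1.
have d0 : 0 < d by lra.
have z0 : 0 < Normc.normc z by apply: lt_le_trans dz.
have zn0 : z != 0 by apply: contraTneq z0 => ->; rewrite Normc.normc0 ltxx.
have ME : M = z^-1 *: (A - s%:C *: (dmx b *m M - M *m dmx b')).
  by rewrite AE addrK scalerA mulVf // scale1r.
have := opboundB aA (opboundZ s%:C (opboundB (opboundM Bb mM) (opboundM mM Bb'))).
move=> /(opboundZ z^-1); rewrite -ME normcZ ger0_norm // => H.
have := opnorm_le H; rewrite -muE Normc.normcV mulrC ler_pdivlMr // => mle.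
apply: opbound_le mM; rewrite ler_pdivlMr ?subr_gt0 //; nra.
Qed.

(** The centre of the cell in column [c.1] and row [c.2] when the square is
    cut into [n * n] cells of side [2 / n]. *)
Definition center n (c : 'I_n * 'I_n) : C :=
  (-1 + (2 * c.1%:R + 1) / n%:R) +i* (-1 + (2 * c.2%:R + 1) / n%:R).

Lemma center_dist n (c c' : 'I_n * 'I_n) : c != c' ->
  2 / n%:R <= Normc.normc (center c - center c').
Proof.
move=> cc'.
have dist (i j : 'I_n) : i != j -> 2 / n%:R <=
    `|(-1 + (2 * i%:R + 1) / n%:R) - (-1 + (2 * j%:R + 1) / n%:R)| :> R.
  move=> ij; have n0 : (0 : R) < n%:R by rewrite ltr0n; apply: leq_ltn_trans (ltn_ord i).
  have -> : (-1 + (2 * i%:R + 1) / n%:R) - (-1 + (2 * j%:R + 1) / n%:R)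
     = 2 / n%:R * (i%:R - j%:R) :> R by ring.
  have q0 : 0 <= 2 / n%:R :> R by rewrite divr_ge0 // ltW.
  rewrite normrM (ger0_norm q0) ler_peMr //.
  have [/ltnW ij'|ji] := leqP j.+1 i.
    rewrite ger0_norm ?subr_ge0 ?ler_nat // -natrB // ler1n subn_gt0 ltn_neqAle.
    by rewrite ij' andbT eq_sym.
  rewrite ler0_norm ?subr_le0 ?ler_nat // opprB -natrB // ler1n subn_gt0 ltn_neqAle.
  by rewrite ij -ltnS.
case: c c' cc' => [i1 i2] [j1 j2]; rewrite xpair_eqE negb_and => /orP[] /dist h.
  by apply: le_trans h _; apply: le_trans (abs_Re_le_normc _); rewrite ReD ReN.
apply: le_trans h _; apply: le_trans (abs_Im_le_normc _).
by rewrite /center /=.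
Qed.

Lemma center_square n (c : 'I_n * 'I_n) (z : C) : (0 < n)%N -> centered_square z ->
  centered_square (center c + ((2 * n%:R)^-1)%:C * z).
Proof.
move=> n0 [/andP[x1 x2] /andP[y1 y2]]; have pn : (0 : R) < n%:R by rewrite ltr0n.
have coord (i : 'I_n) (x : R) : -1 <= x -> x <= 1 ->
    -1 <= -1 + (2 * i%:R + 1) / n%:R + (2 * n%:R)^-1 * x <= 1.
  move=> h1 h2.
  have -> : -1 + (2 * i%:R + 1) / n%:R + (2 * n%:R)^-1 * x
    = (- 2 * n%:R + 4 * i%:R + 2 + x) / (2 * n%:R) by field; rewrite gt_eqF.
  rewrite ler_pdivlMr ?ler_pdivrMr ?mulr_gt0 //.
  have i0 : 0 <= i%:R :> R by [].
  have : i.+1%:R <= n%:R :> R by rewrite ler_nat ltn_ord.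
  by rewrite -[i.+1]addn1 natrD => h; apply/andP; split; lra.
by case: z x1 x2 y1 y2 => x y /= x1 x2 y1 y2; split=> /=;
  rewrite mul0r ?subr0 ?addr0; apply: coord.
Qed.

(** In the class of [c] the diagonal is [center c + s b_c], with [s = 1 / (2
    n)] so that the image of the square stays in the cell and cells remain
    separated relative to their size: distinct centres are at distance at
    least [2 / n = 4 s], while the perturbation in the Sylvester equation
    between two classes is at most [3 s] times the solution. There are at most
    [n ^ 4] pairs of classes. *)
Lemma solvable_grid n (col : 'I_m -> 'I_n * 'I_n) A a S l :
  (0 < n)%N -> opbound a A -> 0 <= l ->
  (forall c, solvable A [set p in S | col p == c]%SET l) ->
  solvable A S (2 * n%:R * l + n%:R ^+ 4 * (2 * n%:R * a)).
Proof.
move=> n0 aA l0 sol; have pn : (0 : R) < n%:R by rewrite ltr0n.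
have {sol} /choice [b /choice [X HX]] c := solvable_supported (sol c).
pose s : R := (2 * n%:R)^-1.
have s0 : 0 <= s by rewrite invr_ge0 mulr_ge0.
have sn : s * (2 * n%:R) = 1 by rewrite /s mulVf // gt_eqF // mulr_gt0.
have sd : 3 * s < 2 / n%:R.
  have -> : 2 / n%:R = 4 * s by rewrite /s; field; rewrite gt_eqF.
  by rewrite ltr_pM2r ?ltr_nat // invr_gt0 mulr_gt0.
pose beta p := center (col p) + s%:C * b (col p) p.
have sep p q : col p != col q -> beta p - beta q != 0.
  move=> pq; apply: contraTneq (center_dist pq) => E; rewrite -ltNge.
  have -> : center (col p) - center (col q) = s%:C * (b (col q) q - b (col p) p).
    by rewrite -[RHS]add0r -E /beta; ring.
  rewrite Normc.normcM normcZ ger0_norm //; apply: le_lt_trans sd.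
  rewrite mulrC ler_wpM2r //; apply: le_trans (le_normcD _ _) _.
  rewrite normcN; have [h1 _ _ _] := HX (col q); have [h2 _ _ _] := HX (col p).
  have := centered_square_normc (h1 q); have := centered_square_normc (h2 p); lra.
(* [D] collects the diagonal blocks and [Y] the off-diagonal ones. *)
pose D := \matrix_(p, q) X (col p) p q.
pose Y : 'M[C]_m := \matrix_(p, q)
  if [&& p \in S, q \in S & col p != col q] then A p q / (beta p - beta q) else 0.
have XE c p q : X c p q =
    if [&& p \in S, col p == c, q \in S & col q == c] then X c p q else 0.
  have [_ _ cX _] := HX c; rewrite -{1}cX compressE !finset.inE.
  by case: (p \in S); case: (q \in S); case: (col p == c); case: (col q == c).
exists beta, ((2 * n%:R)%:C *: D + Y); split.
- move=> p; apply: center_square => //; by have [h _ _ _] := HX (col p); apply: h.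
- apply/matrixP => p q; rewrite commutator_dmxE compressE [(_ + Y) p q]mxE.
  rewrite [(_ *: D) p q]mxE [D p q]mxE [Y p q]mxE XE eqxx /=.
  case pS : (p \in S); case qS : (q \in S) => /=; rewrite ?mulr0 ?addr0 ?mulr0 //.
  have [qp|qp] := eqVneq (col q) (col p).
    rewrite /beta qp /= addr0 opprD addrACA subrr add0r -mulrBr.
    rewrite mulrACA -rmorphM sn rmorph1 mul1r -commutator_dmxE.
    by have [_ <- _ _] := HX (col p); rewrite compressE !finset.inE pS qS qp eqxx.
  by rewrite /= mulr0 add0r mulrC divfK // sep // eq_sym.
have -> : 2 * n%:R * l = Normc.normc ((2 * n%:R)%:C : C) * l.
  by rewrite normcZ ger0_norm // mulr_ge0.
apply: opboundD.
  apply: opboundZ; apply: opbound_blocks => // c; first by have [_ _ _ h] := HX c.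
  apply/matrixP => p q; rewrite compressE !finset.inE.
  by rewrite XE; case: (col p == c); case: (col q == c); rewrite ?andbF //; case: ifP.
pose P c := proj R [set p in S | col p == c]%SET : 'M[C]_m.
(* [Y] is cut into its blocks, each of which solves a Sylvester equation. *)
pose Z (u : ('I_n * 'I_n) * ('I_n * 'I_n)) := P u.1 *m Y *m P u.2.
have ZE u p q : Z u p q = if [&& p \in S, q \in S, col p == u.1, col q == u.2
    & col p != col q] then A p q / (beta p - beta q) else 0.
  rewrite /Z mul_projE proj_mulE !mxE !finset.inE.
  case: (p \in S); case: (q \in S); case: (col p == u.1); case: (col q == u.2);
  by rewrite ?mul0r ?mulr0 // mul1r mulr1.
have -> : Y = \sum_u Z u.
  apply/matrixP => p q; rewrite summxE (bigD1 (col p, col q)) //= ZE /= !eqxx /=.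
  rewrite big1 ?addr0 ?mxE // => [[c c']]; rewrite xpair_eqE ZE /=.
  by rewrite [c == _]eq_sym [c' == _]eq_sym; case: (col p == c); case: (col q == c');
    rewrite ?andbF.
have -> : n%:R ^+ 4 = #|{: ('I_n * 'I_n) * ('I_n * 'I_n)}|%:R :> R.
  by rewrite !card_prod card_ord -natrX; congr _%:R; rewrite !expnS expn0 muln1 !mulnA.
apply: opbound_sum => [|[c c'] _]; first by rewrite !mulr_ge0 // aA.1.
have [cc'|cc'] := eqVneq c c'.
  have -> : Z (c, c') = 0.
    apply/matrixP => p q; rewrite ZE !mxE /= cc'.
    have [->|pc] /= := eqVneq (col p) c'; last by rewrite !andbF.
    by rewrite [col q == _]eq_sym andbN !andbF.
  by apply: opbound_le (opbound0 _ _); rewrite !mulr_ge0 // aA.1.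
have -> : 2 * n%:R * a = a / (2 / n%:R - 3 * s).
  by rewrite /s; field; rewrite !gt_eqF //; lra.
have [bc _ _ _] := HX c; have [bc' _ _ _] := HX c'.
have aPAP : opbound a (P c *m A *m P c').
  have := opboundM (opboundM (opbound_proj R [set p in S | col p == c]%SET) aA)
    (opbound_proj R [set p in S | col p == c']%SET).
  by rewrite mul1r mulr1.
apply: (opbound_sylvester bc bc' s0 (center_dist cc') sd aPAP).
apply/matrixP => p q; rewrite sylvesterE mul_projE proj_mulE ZE /= !finset.inE.
case: (p \in S); case: (q \in S); rewrite ?mul0r ?mulr0 //.
have [pc|pc] := eqVneq (col p) c; have [qc|qc] := eqVneq (col q) c';
  rewrite /= ?mul0r ?mulr0 //.
have pq : col p != col q by rewrite pc qc.
rewrite pq mul1r mulr1.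
have := sep _ _ pq; rewrite /beta pc qc => nz.
rewrite mulrC -mulrA; have -> : center c - center c' + s%:C * (b c p - b c' q)
  = center c + s%:C * b c p - (center c' + s%:C * b c' q) by ring.
by rewrite mulVf // mulr1.
Qed.

End Grid.

(** * The recursion on the number of indices *)

Section Recursion.
Variables (R : realType).
Local Notation C := R[i].

Lemma solvable_le1 m (A : 'M[C]_m) (S : {set 'I_m}) :
  zero_diagonal A -> (#|S| <= 1)%N -> solvable A S 0.
Proof.
move=> A0 S1; exists (fun=> 0), 0; split; last exact: opbound0.
- by move=> _; split=> /=; rewrite lerN10 ler01.
- apply/matrixP => p q; rewrite commutator_dmxE subrr mul0r compressE.
  by case: ifP => // /andP[pS qS]; rewrite (card_le1_eqP S1 _ _ pS qS) A0.
Qed.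

(** Every index gets its own cell; this starts the induction and loses a power
    of [M]. *)
Lemma solvable_crude m (A : 'M[C]_m) a (S : {set 'I_m}) M :
  zero_diagonal A -> opbound a A -> (0 < M)%N -> (#|S| <= M)%N ->
  solvable A S (M%:R ^+ 4 * (2 * M%:R * a)).
Proof.
case: M => // M A0 aA _ SM.
pose col p : 'I_M.+1 * 'I_M.+1 := (inord (index p (enum S)), ord0).
rewrite -[X in solvable _ _ X]add0r -[X in X + _](mulr0 (2 * M.+1%:R)).
apply: (solvable_grid (col := col)) => // c; apply: solvable_le1 => //.
apply/card_le1_eqP => p q; rewrite !finset.inE => /andP[pS /eqP pc] /andP[qS /eqP qc].
have idx r : r \in S -> (index r (enum S) < M.+1)%N.
  by move=> rS; apply: leq_trans SM; rewrite cardE index_mem mem_enum.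
move: pc; rewrite -qc => -[/(congr1 val)]; rewrite /= !inordK ?idx // => E.
by apply: (index_inj p _ _ (esym E)); rewrite mem_enum.
Qed.

(** The classes of norm [128 / 2 ^ L] fill a grid with [n = 2 ^ L * L], at the
    cost of a factor [2 n]; the product of the two is [256 L]. The final 2 x 2
    grid, which separates these classes from the remainder [T], multiplies by
    4. *)
Lemma solvable_step m (A : 'M[C]_m) a (S : {set 'I_m}) L l :
  zero_diagonal A -> opbound a A -> (2 <= L)%N -> (4 ^ L * 2 ^ L <= #|S|)%N ->
  0 <= l ->
  (forall (A' : 'M[C]_m) a' (T : {set 'I_m}), zero_diagonal A' -> opbound a' A' ->
     (#|T| * 2 ^ L.-1 <= #|S|)%N -> solvable A' T (l * a')) ->
  solvable A S ((1024 * L%:R * l + (8 * (2 ^ L * L)%:R ^+ 5 + 64)) * a).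
Proof.
move=> A0 aA L2 SL l0 rec; have a0 := aA.1.
have [T [g [TS gJ cls dec]]] := partition_small_compressions S A0 aA L2.
pose U := (S :\: T)%SET.
have p2 : (2 ^ L = 2 * 2 ^ L.-1)%N by rewrite -expnS prednK //; lia.
have solT : solvable A T (l * a).
  apply: (rec A a T A0 aA); case: dec => dec.
    by apply: (leq_trans _ SL); apply: leq_mul; [exact: ltnW | rewrite p2 leq_pmull].
  by apply: (leq_trans _ dec); rewrite leq_mul2l p2 leq_pmull ?orbT.
set n := (2 ^ L * L)%N; have n0 : (0 < n)%N by rewrite muln_gt0 expn_gt0; lia.
have nn : (4 ^ L * L <= n * n)%N.
  rewrite /n mulnACA -expnMn leq_mul2l; apply/orP; right; nia.
have solU : solvable A U (2 * n%:R * (l * (128 / 2 ^+ L * a)) + n%:R ^+ 4 * (2 * n%:R * a)).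
  case: n n0 nn => // n' _ nn.
  pose col p : 'I_n'.+1 * 'I_n'.+1 := (inord (g p %/ n'.+1), inord (g p %% n'.+1)).
  apply: (solvable_grid (col := col)) => // [|c].
    by rewrite !mulr_ge0 // divr_ge0 // exprn_ge0.
  pose j := (c.1 * n'.+1 + c.2)%N.
  have -> : [set p in U | col p == c]%SET = [set p in U | g p == j]%SET.
    apply/setP => p; rewrite finset.inE [RHS]finset.inE; apply: andb_id2l => pU.
    have gn : (g p < n'.+1 * n'.+1)%N by apply: leq_trans nn; apply: gJ.
    apply/eqP/eqP => [cE|gj].
      by rewrite /j -cE /col /= !inordK ?ltn_mod ?ltn_divLR // -divn_eq.
    rewrite /col gj /j divnMDl // divn_small // addn0 modnMDl modn_small //.
    by rewrite !inord_val -surjective_pairing.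
  have [szj bj] := cls j; apply: solvable_compress; apply: rec => //.
    by move=> p; rewrite compressE A0; case: ifP.
  move: szj; set x := #|_|; set y := #|S|; rewrite -[4%N]/(2 * 2)%N expnMn p2 => szj.
  have : (0 < 2 ^ L.-1)%N by rewrite expn_gt0.
  move: szj; set z := (2 ^ L.-1)%N; nia.
have EU : 2 * n%:R * (l * (128 / 2 ^+ L * a)) + n%:R ^+ 4 * (2 * n%:R * a)
    = (256 * L%:R * l + 2 * n%:R ^+ 5) * a.
  rewrite /n natrM natrX; field; by rewrite expf_neq0 // pnatr_eq0.
rewrite EU in solU; clear EU; clearbody n.
have -> : (1024 * L%:R * l + (8 * n%:R ^+ 5 + 64)) * a =
    2 * 2%:R * ((256 * L%:R * l + 2 * n%:R ^+ 5) * a) + 2%:R ^+ 4 * (2 * 2%:R * a).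
  by ring.
have L1 : 1 <= L%:R :> R by rewrite ler1n; lia.
have n5 : 0 <= n%:R ^+ 5 :> R by rewrite exprn_ge0.
have pos : 0 <= (256 * L%:R * l + 2 * n%:R ^+ 5) * a.
  have Ll := mulr_ge0 (le_trans ler01 L1) l0.
  by apply: mulr_ge0 a0; move: Ll n5; clear; lra.
(* Two of the four cells stay empty. *)
pose col p : 'I_2 * 'I_2 := if p \in T then (ord0, ord0) else (ord_max, ord_max).
apply: (solvable_grid (col := col)) => // c.
have [->|c0] := eqVneq c (ord0, ord0).
  have -> : [set p in S | col p == (ord0, ord0)]%SET = T.
    apply/setP => p; rewrite finset.inE /col; case: ifP => pT.
      by rewrite eqxx andbT (fintype.subsetP TS).
    by rewrite xpair_eqE /= andbF.
  apply: solvable_le solT; rewrite ler_wpM2r //.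
  by nra.
have [->|c1] := eqVneq c (ord_max, ord_max).
  have -> : [set p in S | col p == (ord_max, ord_max)]%SET = U.
    apply/setP => p; rewrite !finset.inE /col; case: ifP => pT.
      by rewrite xpair_eqE /= andbF.
    by rewrite eqxx andbT.
  by [].
apply: (@solvable_le _ _ _ _ 0); first exact: pos.
apply: solvable_le1 => //; rewrite (_ : [set p in S | col p == c]%SET = finset.set0).
  by rewrite cards0.
apply/setP => p; rewrite !finset.inE /col; case: ifP => _.
  by rewrite [_ == c]eq_sym (negPf c0) andbF.
by rewrite [_ == c]eq_sym (negPf c1) andbF.
Qed.

Lemma bernoulli (y : R) n : 0 <= y -> 1 + n%:R * y <= (1 + y) ^+ n.
Proof.
move=> y0; elim: n => [|n IH]; first by rewrite mul0r addr0 expr0.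
rewrite exprS -[n.+1]addn1 natrD.
have : (1 + y) * (1 + n%:R * y) <= (1 + y) * (1 + y) ^+ n.
  by rewrite ler_wpM2l // addr_ge0.
have : 0 <= n%:R * y * y by rewrite !mulr_ge0.
by move=> h1 h2; lra.
Qed.

(** With [x = 2 ^ g > 1], the right-hand side along odd [L = 2 n + 3] is [(x ^
    (n + 1)) ^ 2], which grows at least quadratically in [n] by the inequality
    of Bernoulli. *)
Lemma linear_le_powR (c g : R) : 0 < g ->
  exists2 L, (2 <= L)%N & c * L%:R <= powR (2 ^ L.-1)%:R g.
Proof.
move=> g0; pose x : R := powR 2 g.
have one : powR 1 g = 1 by rewrite powR1.
have x1 : 1 < x by rewrite /x -[ltLHS]one gt0_ltr_powR // ?nnegrE // ltr1n.
have y0 : 0 < x - 1 by rewrite subr_gt0.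
pose y := x - 1.
have [n nP] : exists n : nat, 3 * `|c| / y ^+ 2 <= n%:R.
  by exists (Num.truncn (3 * `|c| / y ^+ 2)).+1; apply/ltW/truncnS_gt.
exists (2 * n.+1).+1; first by lia.
rewrite /= natrX -powR_mulrn // -powRrM [_ * g]mulrC powRrM -/x powR_mulrn; last exact: (ltW (lt_trans ltr01 x1)).
rewrite mulnC exprM.
have xE : x = 1 + y by rewrite /y addrC subrK.
have b1 : n.+1%:R * y <= x ^+ n.+1.
  have := bernoulli n.+1 (ltW y0); rewrite -/y -xE => h.
  by apply: le_trans h; rewrite lerDr.
have b2 : (n.+1%:R * y) ^+ 2 <= (x ^+ n.+1) ^+ 2.
  by rewrite ler_pXn2r ?nnegrE // ?exprn_ge0 ?mulr_ge0 // ?ltW // (lt_trans ltr01).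
apply: le_trans b2; rewrite ler_pdivrMr ?exprn_gt0 // in nP.
have n1 : n.+1%:R = n%:R + 1 :> R by rewrite -natr1.
have nR0 : 0 <= n%:R :> R by [].
have -> : (n.+1 * 2).+1%:R = 2 * n.+1%:R + 1 :> R by rewrite -natr1 natrM mulrC.
rewrite exprMn; have cc := ler_norm c; have c0 := normr_ge0 c.
have yy : 0 <= y ^+ 2 by rewrite sqr_ge0.
apply: (@le_trans _ _ (3 * `|c| * n.+1%:R)); first by nra.
rewrite [leLHS]mulrC [_%:R ^+ 2]expr2 -[leRHS]mulrA ler_wpM2l //.
by apply: le_trans nP _; rewrite ler_wpM2r // ler_nat.
Qed.

(** The parameter [L] is fixed so that [1024 L] is at most half of [q ^ g],
    where [q = 2 ^ (L - 1)] is the factor by which the size decreases. In the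
    inductive step half of [K |S| ^ g] then pays for the recursive term, and
    the other half for the additive constant [D]. *)
Lemma solvable_powR (g : R) : 0 < g -> exists2 K : R, 0 <= K &
  forall m (A : 'M[C]_m) a (S : {set 'I_m}), zero_diagonal A -> opbound a A ->
    solvable A S (K * powR #|S|%:R g * a).
Proof.
move=> g0; have [L L2 LP] := linear_le_powR 2048 g0.
set q := (2 ^ L.-1)%N in LP; pose M := (4 ^ L * 2 ^ L)%N.
pose D : R := 8 * (2 ^ L * L)%:R ^+ 5 + 64.
have D0 : 0 <= D by rewrite addr_ge0 ?mulr_ge0 ?exprn_ge0.
have M0 : (0 < M)%N by rewrite muln_gt0 !expn_gt0.
pose E : R := M%:R ^+ 4 * (2 * M%:R).
have E0 : 0 <= E by rewrite !mulr_ge0 ?exprn_ge0.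
have [K [K0 KE KD]] : exists K, [/\ 0 <= K, E <= K & 2 * D <= K].
  by exists (E + 2 * D); split; rewrite ?addr_ge0 ?lerDl ?lerDr // mulr_ge0.
exists K => //.
move=> m A a S; have [s] := ubnP #|S|; elim: s A a S => // s IH A a S Ss A0 aA.
have a0 := aA.1.
have [S1|S1] := leqP #|S| 1.
  by apply: solvable_le (solvable_le1 A0 S1); rewrite !mulr_ge0 ?powR_ge0.
have P1 : 1 <= powR #|S|%:R g.
  have one : powR 1 g = 1 by rewrite powR1.
  rewrite -[leLHS]one; apply: ge0_ler_powR; rewrite ?nnegrE //; first exact: ltW.
  by rewrite ler1n ltnW.
have [SM|SM] := leqP #|S| M.
  apply: solvable_le (solvable_crude A0 aA M0 SM).
  rewrite mulrA ler_wpM2r // -/E; apply: (@le_trans _ _ (K * 1)).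
    by rewrite mulr1.
  by rewrite ler_wpM2l.
have q1 : (2 <= q)%N by rewrite -{1}[2%N]expn1 leq_exp2l // -ltnS prednK // ltnW.
have q0 : (0 : R) < q%:R by rewrite ltr0n ltnW.
pose l := K * powR (#|S|%:R / q%:R) g.
have l0 : 0 <= l by rewrite mulr_ge0 ?powR_ge0.
apply: solvable_le (solvable_step A0 aA L2 (ltnW SM) l0 _) => [|A' a' T A0' aA' TS].
  rewrite ler_wpM2r // /l.
  have -> : powR (#|S|%:R / q%:R) g = powR #|S|%:R g / powR q%:R g.
    by rewrite powRM ?invr_ge0 // -powR_inv1 // -powRrM mulN1r powRN.
  have Q0 : 0 < powR q%:R g by rewrite powR_gt0.
  have H : 1024 * L%:R * (K * (powR #|S|%:R g / powR q%:R g)) <= K * powR #|S|%:R g / 2.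
    have -> : 1024 * L%:R * (K * (powR #|S|%:R g / powR q%:R g)) =
       (K * powR #|S|%:R g / 2) * ((2048 * L%:R) / powR q%:R g).
      by field; rewrite gt_eqF.
    apply: ler_piMr; first by rewrite divr_ge0 // mulr_ge0 // powR_ge0.
    by rewrite ler_pdivrMr // mul1r.
  have H2 : D <= K * powR #|S|%:R g / 2.
    rewrite ler_pdivlMr // mulrC; apply: (@le_trans _ _ (K * 1)).
      by rewrite mulr1.
    by rewrite ler_wpM2l.
  by rewrite -/D; lra.
apply: solvable_le (IH A' a' T _ A0' aA').
  rewrite ler_wpM2r ?aA'.1 // /l ler_wpM2l //.
  apply: ge0_ler_powR; rewrite ?nnegrE ?divr_ge0 //; first exact: ltW.
  by rewrite ler_pdivlMr // -natrM ler_nat.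
by move: TS q1 S1 Ss; rewrite -/q; clear; nia.
Qed.

End Recursion.

(** * Matrices of zero trace *)

Section ZeroDiagonal.
Variables (R : realType) (m : nat).
Local Notation C := R[i].
Implicit Types (A U : 'M[C]_m) (x y v : 'cV[C]_m) (T : {set 'I_m}).

Let entryD (M N : 'M[C]_1) : (M + N) 0 0 = M 0 0 + N 0 0.
Proof. by rewrite mxE. Qed.

Let entryB (M N : 'M[C]_1) : (M - N) 0 0 = M 0 0 - N 0 0.
Proof. by rewrite !mxE. Qed.

Let entryZ (c : C) (M : 'M[C]_1) : (c *: M) 0 0 = c * M 0 0.
Proof. by rewrite mxE. Qed.

Definition cform A x y : C := (x^t* *m A *m y) 0 0.

Lemma cform_addl A x y z : cform A (x + y) z = cform A x z + cform A y z.
Proof. by rewrite /cform adjmxD !mulmxDl entryD. Qed.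

Lemma cform_addr A x y z : cform A z (x + y) = cform A z x + cform A z y.
Proof. by rewrite /cform mulmxDr entryD. Qed.

Lemma cform_scalel A (c : C) x y : cform A (c *: x) y = Num.conj c * cform A x y.
Proof. by rewrite /cform adjmxZ -!scalemxAl entryZ. Qed.

Lemma cform_scaler A (c : C) x y : cform A x (c *: y) = c * cform A x y.
Proof. by rewrite /cform -scalemxAr entryZ. Qed.

Lemma cformD A x y (c : C) :
  cform A (x + c *: y) (x + c *: y) =
  cform A x x + c * cform A x y + Num.conj c * cform A y x
  + c * Num.conj c * cform A y y.
Proof.
rewrite cform_addl !cform_addr !cform_scalel !cform_scaler mulrCA mulrA.
by rewrite addrA.
Qed.

Lemma cformZ A x (c : C) : cform A (c *: x) (c *: x) = c * Num.conj c * cform A x x.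
Proof. by rewrite cform_scalel cform_scaler mulrCA mulrA. Qed.

Lemma cform1 x : cform 1%:M x x = (rdot x x)%:C.
Proof.
by rewrite /cform mulmx1 /rdot; apply: (@herm_diag_real _ 1 (x^t* *m x) 0); rewrite adjmxM adjmxK.
Qed.

Lemma cformB A (c : C) x : cform (A - c%:M) x x = cform A x x - c * (rdot x x)%:C.
Proof.
by rewrite -cform1 /cform mulmxBr mulmxBl mul_mx_scalar -scalemxAl mulmx1 entryB entryZ.
Qed.

Lemma cform_basis A i : cform A (basis R i) (basis R i) = A i i.
Proof. by rewrite /cform basis_entry mxE eqxx. Qed.

(** The condition is one real linear equation in the real and imaginary parts
    of [t], so it has a nonzero solution. *)
Lemma exists_phase (u v : C) : exists2 t : C, t != 0 &
  complex.Im (t * u + Num.conj t * v) = 0.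
Proof.
case: u v => [ur ui] [vr vi].
have [t0|t0] := eqVneq ((vr - ur) +i* (ui + vi)) (0 : C).
  exists 1; rewrite ?oner_eq0 // conjC1 !mul1r /=.
  by case: t0.
by exists ((vr - ur) +i* (ui + vi)) => //; rewrite conjC_conjc /=; ring.
Qed.

Lemma quadratic_root (p g q : R) : 0 < p -> 0 < q ->
  exists s : R, - p + s * g + s ^+ 2 * q = 0.
Proof.
move=> p0 q0; have D0 : 0 <= g ^+ 2 + 4 * q * p by rewrite addr_ge0 ?sqr_ge0 // !mulr_ge0 // ltW.
exists ((- g + Num.sqrt (g ^+ 2 + 4 * q * p)) / (2 * q)).
have := sqr_sqrtr D0; set r := Num.sqrt _ => rE.
have -> : - p + (- g + r) / (2 * q) * g + ((- g + r) / (2 * q)) ^+ 2 * q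
  = (r ^+ 2 - (g ^+ 2 + 4 * q * p)) / (4 * q) by field; rewrite gt_eqF.
by rewrite rE subrr mul0r.
Qed.

(** Two vectors at which the form takes values of opposite directions: after
    the choice of a phase [t] the form at [x + s t y], divided by [k], is a
    real quadratic polynomial in the real variable [s], negative at [0] and
    with positive leading coefficient. This is the algebraic core of the
    convexity of the numerical range. *)
Lemma isotropic_combination A x y (k : C) (p q : R) :
  0 < p -> 0 < q -> k != 0 ->
  cform A x x = - p%:C * k -> cform A y y = q%:C * k ->
  exists c, x + c *: y != 0 /\ cform A (x + c *: y) (x + c *: y) = 0.
Proof.
move=> p0 q0 k0 Ax Ay.
have [t t0 Imt] := exists_phase (cform A x y / k) (cform A y x / k).
set w := _ + _ in Imt.
have wE : w = (complex.Re w)%:C by case: w Imt => a b /= ->.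
have tt : t * Num.conj t = (Normc.normc t ^+ 2)%:C.
  by rewrite sqr_normcE conjC_conjc; case: t {t0 w Imt wE} => a b; apply/eqP;
    rewrite eq_complex /=; apply/andP; split; apply/eqP; ring.
have n0 : 0 < Normc.normc t ^+ 2.
  rewrite exprn_gt0 // lt_def normc_nonneg andbT; apply: contraNneq t0.
  by move=> /Normc.eq0_normc ->.
have cc s : s%:C * t * Num.conj (s%:C * t) = (s ^+ 2 * Normc.normc t ^+ 2)%:C.
  have -> : Num.conj (s%:C * t) = s%:C * Num.conj t.
    by rewrite rmorphM; congr (_ * _); apply: conjC_real.
  by rewrite mulrACA tt -!rmorphM expr2.
have [s sE] := quadratic_root (complex.Re w) p0 (mulr_gt0 n0 q0).
exists (s%:C * t); split.
  apply/eqP => /eqP; rewrite addr_eq0 -scaleNr => /eqP xE.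
  move: Ax; rewrite xE cformZ Ay rmorphN mulrNN cc => /eqP.
  rewrite mulrA -subr_eq0 -mulrBl mulf_eq0 (negPf k0) orbF -rmorphN -rmorphM -rmorphB.
  rewrite -(rmorph0 (real_complex R)) => /eqP/complexI E.
  suff : 0 < s ^+ 2 * Normc.normc t ^+ 2 * q + p by lra.
  have q0' := ltW q0; have := mulr_ge0 (mulr_ge0 (sqr_ge0 s) (sqr_ge0 (Normc.normc t))) q0'; lra.
rewrite cformD Ax Ay cc.
transitivity (k * (- p%:C + s%:C * w + (s ^+ 2 * Normc.normc t ^+ 2)%:C * q%:C)).
  have -> : Num.conj (s%:C * t) = s%:C * Num.conj t.
    by rewrite rmorphM; congr (_ * _); apply: conjC_real.
  by rewrite /w; field.
rewrite wE -!rmorphM -rmorphN -!rmorphD -[s ^+ 2 * _ * q]mulrA sE.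
by rewrite rmorph0 mulr0.
Qed.

Definition supported T x := forall i, i \notin T -> x i 0 = 0.

Lemma supported_basis T i : i \in T -> supported T (basis R i).
Proof.
move=> iT j jT; rewrite mxE; have [ji|//] := eqVneq j i.
by rewrite -ji (negPf jT) in iT.
Qed.

Lemma basis_neq0 (i : 'I_m) : basis R i != 0.
Proof.
apply/eqP => /matrixP/(_ i 0); rewrite !mxE !eqxx => /eqP.
by rewrite oner_eq0.
Qed.

Lemma rdot_basis_self (i : 'I_m) : rdot (basis R i) (basis R i) = 1.
Proof. by rewrite -[X in rdot _ X]mul1mx rdot_basis mxE eqxx. Qed.

(** The numerical range is convex, so it contains the average of the diagonal
    entries. One basis vector is added at a time: relative to the new average,
    the value at the vector found so far and the value at the new basis vector
    have opposite directions. *)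
Lemma numerical_range_average A T : T != finset.set0 ->
  exists x, [/\ x != 0, supported T x &
    #|T|%:R * cform A x x = (\sum_(i in T) A i i) * (rdot x x)%:C].
Proof.
have [n] := ubnP #|T|; elim: n T => // n IH T Tn /set0Pn[i iT].
have cT : #|T| = #|(T :\ i)%SET|.+1 by rewrite (cardsD1 i) iT.
have [T1|T1] := eqVneq (T :\ i)%SET finset.set0.
  exists (basis R i); split; [exact: basis_neq0 | exact: supported_basis |].
  rewrite cT T1 cards0 mul1r cform_basis rdot_basis_self mulr1.
  by rewrite (finset.big_setD1 i) //= T1 finset.big_set0 addr0.
have [||x [x0 xT xE]] := IH (T :\ i)%SET => //; first by rewrite -ltnS -cT.
have n0 : (0 < #|(T :\ i)%SET|)%N by rewrite card_gt0.
set N := #|(T :\ i)%SET| in xE n0 cT.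
have xT' : supported T x.
  by move=> j jT; apply: xT; rewrite finset.inE negb_and jT orbT.
have NC : N%:R != 0 :> C by rewrite pnatr_eq0 -lt0n.
have NC1 : N.+1%:R != 0 :> C by rewrite pnatr_eq0.
pose g : C := (\sum_(j in T) A j j) / N.+1%:R.
have gE : \sum_(j in T) A j j = N.+1%:R * g by rewrite mulrC divfK.
have rx : 0 < rdot x x.
  rewrite lt_def rdotxx_ge0 andbT; apply: contraNneq x0 => /rdotxx_eq0 ->.
  by [].
have sE : \sum_(j in (T :\ i)%SET) A j j = N%:R * g - (A i i - g).
  have := gE; rewrite (finset.big_setD1 i) //= => S1.
  apply: (addrI (A i i)); rewrite S1 -natr1; ring.
rewrite cT gE; have [k0|k0] := eqVneq (A i i - g) 0.
  exists (basis R i); split; [exact: basis_neq0 | exact: supported_basis |].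
  by rewrite cform_basis rdot_basis_self mulr1; congr (_ * _); apply/eqP; rewrite -subr_eq0 k0.
have [||||c [z0 zE]] := @isotropic_combination (A - g%:M) x (basis R i) (A i i - g)
    (rdot x x / N%:R) 1 _ _ k0.
- by rewrite divr_gt0 // ltr0n.
- by [].
- rewrite cformB; apply: (mulfI NC); rewrite mulrBr xE sE rmorphM fmorphV rmorph_nat.
  by field.
- by rewrite cformB cform_basis rdot_basis_self rmorph1 mulr1 mul1r.
exists (x + c *: basis R i); split=> //.
  move=> j jT; rewrite mxE xT' // mxE (supported_basis iT jT) mulr0 addr0 //.
by move: zE; rewrite cformB => /eqP; rewrite subr_eq0 => /eqP ->; rewrite mulrA.
Qed.

(** The Householder reflection exchanging the basis vector and [x]; it is
    unitary because the inner product of the two vectors is real. *)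
Lemma reflection_to x k T : supported T x -> k \in T -> rdot x x = 1 ->
  complex.Im (x k 0) = 0 ->
  exists U, [/\ U \is unitarymx, U *m basis R k = x &
    forall j, j \notin T -> U *m basis R j = basis R j].
Proof.
move=> xT kT x1 xk; pose e := basis R k; pose v := x - e.
have [v0|v0] := eqVneq v 0.
  exists 1%:M; split; last by move=> j _; rewrite mul1mx.
    by apply/unitarymxP; rewrite adjmx1 mul1mx.
  by rewrite mul1mx; apply/eqP; rewrite eq_sym -subr_eq0 -/e -/v v0.
pose N := rdot v v.
have N0 : N != 0 by apply: contraNneq v0 => /rdotxx_eq0 ->.
have vv : v^t* *m v = (N%:C)%:M.
  by rewrite [LHS]mx11_scalar; congr _%:M; rewrite -cform1 /cform mulmx1.
have vE j : v^t* *m basis R j = (Num.conj (v j 0))%:M.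
  by rewrite -colE [LHS]mx11_scalar !mxE.
have NE : N = 2 * (1 - complex.Re (x k 0)).
  rewrite /N rdotDl !rdotDr !rdotNl !rdotNr x1 rdot_basis_self (rdotC e).
  have -> : rdot x e = complex.Re (x k 0).
    rewrite rdotC; have := rdot_basis (x *m (delta_mx 0 k : 'rV_m)) k k.
    rewrite -mulmxA [(delta_mx 0 k : 'rV_m) *m _]mul_delta_mx.
    have -> : (delta_mx 0 0 : 'M[C]_1) = 1%:M.
      by apply/matrixP => a b; rewrite !ord1 !mxE eqxx.
    rewrite mulmx1 => ->; rewrite mxE big_ord1 !mxE !eqxx mulr1 //.
  by ring.
pose U := 1%:M - (2 / N)%:C *: (v *m v^t*).
have hU : U^t* = U by rewrite adjmxB adjmx1 adjmxZ conjC_real adjmxM adjmxK.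
exists U; split.
- apply/unitarymxP; rewrite hU /U mulmxBl mul1mx mulmxBr mulmx1.
  rewrite -!scalemxAl -!scalemxAr scalerA mulmxA -[v *m v^t* *m v]mulmxA vv.
  rewrite mul_mx_scalar -scalemxAl scalerA -!rmorphM.
  have -> : 2 / N * (2 / N) * N = 2 / N + 2 / N by field.
  by rewrite rmorphD scalerDl opprB addrK subrK.
- rewrite mulmxBl mul1mx -scalemxAl -mulmxA vE mul_mx_scalar scalerA.
  have -> : Num.conj (v k 0) = (- (N / 2))%:C.
    rewrite NE !mxE !eqxx; case: (x k 0) xk => a b /= ->.
    by apply/eqP; rewrite eq_complex /=; apply/andP; split; apply/eqP; field.
  rewrite -rmorphM; have -> : 2 / N * - (N / 2) = -1 by field.
  by rewrite rmorphN rmorph1 scaleN1r opprK /v addrC subrK.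
move=> j jT; rewrite mulmxBl mul1mx -scalemxAl -mulmxA vE mul_mx_scalar.
rewrite !mxE xT // eq_sym; have [kj|_] := eqVneq k j.
  by rewrite -kj kT in jT.
by rewrite subr0 conjC0 scale0r scaler0 subr0.
Qed.

Lemma unitary_conj_entry A U i j :
  (U^t* *m A *m U) i j = cform A (U *m basis R i) (U *m basis R j).
Proof.
rewrite /cform adjmxM; have := basis_entry (U^t* *m A *m U) i j.
by move=> /matrixP/(_ 0 0); rewrite [RHS]mxE eqxx mulr1n !mulmxA.
Qed.

Lemma unitary_trace A U : U \is unitarymx -> \tr (U^t* *m A *m U) = \tr A.
Proof. by move=> /unitarymxP UU; rewrite mxtrace_mulC mulmxA UU mul1mx. Qed.

(** One diagonal entry is annihilated at a time. [T] is the set of entries not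
    yet annihilated; as their sum is the trace, their average is zero, and it
    is the value of the form at a vector supported in [T]. Reflecting a basis
    vector to it does not affect the entries outside [T]. *)
Lemma zero_diagonal_unitary A : \tr A = 0 ->
  exists2 U : 'M[C]_m, U \is unitarymx & zero_diagonal (U^t* *m A *m U).
Proof.
move=> tA; suff gen n : forall (B : 'M[C]_m) (T : {set 'I_m}), (#|T| <= n)%N -> \tr B = 0 ->
    (forall j, j \notin T -> B j j = 0) ->
    exists2 U : 'M[C]_m, U \is unitarymx & zero_diagonal (U^t* *m B *m U).
  by apply: (gen m A finset.setT) => // [|j]; rewrite ?cardsT ?card_ord // finset.inE.
elim: n => [|n IH] B T Tn tB B0.
  exists 1%:M; first by apply/unitarymxP; rewrite adjmx1 mul1mx.
  move=> j; rewrite adjmx1 mul1mx mulmx1 B0 //.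
  by move: Tn; rewrite leqn0 cards_eq0 => /eqP ->; rewrite finset.in_set0.
have [T0|T0] := eqVneq T finset.set0.
  by apply: (IH B T) => //; rewrite T0 cards0.
have sB : \sum_(i in T) B i i = 0.
  apply: etrans tB; rewrite /mxtrace [RHS](bigID (fun i => i \in T)) /=.
  by rewrite [X in _ + X]big1 ?addr0.
have [x [x0 xT xE]] := numerical_range_average B T0.
have /set0Pn[k kT] := T0.
have xB : cform B x x = 0.
  move/eqP: xE; rewrite sB mul0r mulf_eq0 pnatr_eq0 cards_eq0 (negPf T0).
  by move=> /eqP.
have rx : 0 < rdot x x.
  by rewrite lt_def rdotxx_ge0 andbT; apply: contraNneq x0 => /rdotxx_eq0 ->.
(* A phase makes the entry at [k] real, and a scalar makes the vector unit. *)
have [c c0 xk] : exists2 c : C, c != 0 & complex.Im (c * x k 0) = 0.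
  have [xk0|xk0] := eqVneq (x k 0) 0; first by exists 1; rewrite ?oner_eq0 // xk0 mulr0.
  exists (Num.conj (x k 0)); first by rewrite conjC_eq0.
  by rewrite conjC_conjc; case: (x k 0) => a b /=; ring.
pose y := c *: x.
have ry : 0 < rdot y y.
  by rewrite rdotxx_Z mulr_gt0 // exprn_gt0 // lt_def normc_nonneg andbT;
     apply: contraNneq c0 => /Normc.eq0_normc ->.
pose z := (l2norm y)^-1%:C *: y.
have ly : 0 < l2norm y by rewrite l2normE sqrtr_gt0.
have z1 : rdot z z = 1.
  by rewrite rdotZl rdotZr -sqr_l2norm; field; rewrite gt_eqF.
have zT : supported T z by move=> j jT; rewrite !mxE xT // !mulr0.
have zk : complex.Im (z k 0) = 0.
  by rewrite !mxE; case: (c * x k 0) xk => a b /= ->; rewrite mulr0 mul0r addr0.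
have zB : cform B z z = 0 by rewrite !cformZ xB !mulr0.
have [U1 [uU1 U1k U1j]] := reflection_to zT kT z1 zk.
have [|||U2 uU2 zU2] := IH (U1^t* *m B *m U1) (T :\ k)%SET.
- by move: Tn; rewrite (cardsD1 k) kT.
- by rewrite unitary_trace.
- move=> j; rewrite finset.in_setD1 negb_and negbK unitary_conj_entry.
  have [->|jk /= jT] := eqVneq j k; first by rewrite U1k.
  by rewrite U1j // cform_basis B0.
exists (U1 *m U2); first exact: (mul_unitarymx uU1 uU2).
by move=> j; have := zU2 j; rewrite adjmxM !mulmxA.
Qed.

End ZeroDiagonal.

(** * Unitary conjugation of commutators *)

Section Commutators.
Variable R : realType.
Local Notation C := R[i].

Lemma zero_diagonal_commutator (g : R) : 0 < g ->
  exists2 K : R, 0 <= K & forall m (A : 'M[C]_m), zero_diagonal A ->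
    exists b (X : 'M[C]_m), [/\ forall j, centered_square (b j),
      A = commutator (dmx b) X & opnorm X <= K * powR m%:R g * opnorm A].
Proof.
move=> g0; have [K K0 HK] := solvable_powR g0; exists K => // m A A0.
have [b [X [bs AX lX]]] := HK m A _ finset.setT A0 (opbound_opnorm A).
exists b, X; split=> //.
  by rewrite -AX; apply/matrixP => i j; rewrite compressE !finset.in_setT.
by rewrite cardsT card_ord in lX; apply: opnorm_le.
Qed.

Lemma is_diag_dmx m (b : 'I_m -> C) : is_diag_mx (dmx b).
Proof. exact: diag_mx_is_diag. Qed.

Lemma dmx_entry m (b : 'I_m -> C) j : dmx b j j = b j.
Proof. by rewrite !mxE eqxx mulr1n. Qed.

Lemma unitary_conjM m (U M N : 'M[C]_m) : U \is unitarymx ->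
  U *m M *m U^t* *m (U *m N *m U^t*) = U *m (M *m N) *m U^t*.
Proof.
by move=> /unitarymxP/mulmx1C UU; rewrite -!mulmxA [U^t* *m (U *m _)]mulmxA UU mul1mx.
Qed.

Lemma unitary_dmx_normal m (b : 'I_m -> C) (U : 'M[C]_m) : U \is unitarymx ->
  U *m dmx b *m U^t* \is normalmx.
Proof.
move=> uU; have bE : (dmx b)^t* = dmx (fun j => Num.conj (b j)).
  by rewrite /dmx tr_diag_mx map_diag_mx; congr diag_mx; apply/rowP => j; rewrite !mxE.
have adjE : (U *m dmx b *m U^t*)^t* = U *m (dmx b)^t* *m U^t*.
  by rewrite adjmxM adjmxK (adjmxM U) mulmxA.
have bC : dmx b *m (dmx b)^t* = (dmx b)^t* *m dmx b by rewrite bE; apply: diag_mxC.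
by apply/normalmxP; rewrite adjE (unitary_conjM _ _ uU) bC (unitary_conjM _ _ uU).
Qed.

Lemma unitary_dmx_eigenvalue m (b : 'I_m -> C) (U : 'M[C]_m) z : U \is unitarymx ->
  eigenvalue (U *m dmx b *m U^t*) z -> exists j, z = b j.
Proof.
move=> /unitarymxP/mulmx1C UU /eigenvalueP[v vE v0].
have : v *m U != 0.
  by apply: contraNneq v0 => vU; rewrite -[v]mulmx1 -(mulmx1C UU) mulmxA vU mul0mx.
case/rV0Pn => j wj; exists j; apply: (mulIf wj).
have : v *m U *m dmx b = z *: (v *m U).
  by rewrite scalemxAl -vE !mulmxA -[_ *m U^t* *m U]mulmxA UU mulmx1.
move=> /(congr1 (fun w : 'rV[C]_m => w 0 j)) /=.
by rewrite /dmx mul_mx_diag mxE [X in _ * X]mxE [RHS]mxE mulrC => ->.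
Qed.

Lemma commutator_unitary m (B X U : 'M[C]_m) : U \is unitarymx ->
  U *m commutator B X *m U^t* = commutator (U *m B *m U^t*) (U *m X *m U^t*).
Proof.
by move=> uU; rewrite /commutator mulmxBr mulmxBl !unitary_conjM.
Qed.

Lemma opnorm_unitary_le m (A U V : 'M[C]_m) : U \is unitarymx -> V \is unitarymx ->
  opnorm (U *m A *m V) <= opnorm A.
Proof.
move=> uU uV; apply: opnorm_le.
have := opboundM (opboundM (opbound_unitary uU) (opbound_opnorm A)) (opbound_unitary uV).
by rewrite mul1r mulr1.
Qed.

End Commutators.

(** * Commutator representations with power bounds *)

Theorem theorem2 (R : realType) :
  (forall eps : R, 0 < eps ->
     exists K : R, forall m : nat, (0 < m)%N ->
       (lambda R m <= (K * powR m%:R eps)%:E)%E)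
  /\
  (forall eps : R, 0 < eps ->
     exists K : R, forall m : nat, (0 < m)%N ->
       forall A : 'M[R[i]]_m, \tr A = 0 ->
         exists B C : 'M[R[i]]_m,
           [/\ B \is normalmx,
               (forall z : R[i], eigenvalue B z -> centered_square z),
               opnorm C <= K * powR m%:R eps * opnorm A
             & A = commutator B C]).
Proof.
split=> eps /zero_diagonal_commutator[K K0 HK]; exists K => m m0.
  rewrite /lambda; case: ifP => _; first by rewrite lee_fin mulr_ge0 ?powR_ge0.
  apply: ge_ereal_sup => _ [A [A0 A1] <-].
  have [b [X [bs AX Xle]]] := HK m A A0; rewrite A1 mulr1 in Xle.
  apply: ereal_inf_lbound; exists (K * powR m%:R eps) => //=.
  exists (dmx b), X; split=> //; first exact: is_diag_dmx.
  by move=> j; rewrite dmx_entry.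
move=> A /zero_diagonal_unitary[U uU A0].
have UU := unitarymxP uU; have uU' : U^t* \is unitarymx by rewrite trmxC_unitary.
have [b [X [bs AX Xle]]] := HK m _ A0.
exists (U *m dmx b *m U^t*), (U *m X *m U^t*); split.
- exact: unitary_dmx_normal.
- by move=> z /(unitary_dmx_eigenvalue uU)[j ->].
- apply: le_trans (opnorm_unitary_le _ uU uU') _; apply: le_trans Xle _.
  apply: ler_wpM2l; first by rewrite mulr_ge0 // powR_ge0.
  exact: opnorm_unitary_le.
by rewrite -commutator_unitary // -AX !mulmxA UU mul1mx -mulmxA UU mulmx1.
Qed.
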